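(* Let $Y$ be a Banach space which is a quotient of the Schreier space $S$. Then $Y$ is $c_0$-saturated, i.e. every infinite dimensional (closed) subspace of $Y$ contains a subspace isomorphic to $c_0$.
   Context: Let $c_{00}$ be the space of finitely supported real sequences. For $x=(x_i)\in c_{00}$ set $\|x\|=\max\{\sum_{i=1}^p |x_{k_i}| : p\in\mathbb{N},\ p\le k_1<k_2<\cdots<k_p\}$. The Schreier space $S$ is the completion of $(c_{00},\|\cdot\|)$. $Y$ is a quotient of $S$ if there is a bounded linear operator from $S$ onto $Y$. *)

(* Defs.v *)
From HB Require Import structures.
From mathcomp Require Import all_boot all_order all_algebra.
From mathcomp Require Import all_classical all_reals all_analysis.
Set Implicit Arguments. Unset Strict Implicit. Unset Printing Implicit Defensive.
Import Order.TTheory GRing.Theory Num.Theory.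
Import numFieldNormedType.Exports.
Local Open Scope classical_set_scope.
Local Open Scope ring_scope.

(* Schreier-admissible finite sets {k_1 < ... < k_p} with p <= k_1,
   encoded as strictly increasing sequences (the empty set is allowed;
   it contributes 0 to the supremum). *)
Definition schreier_admissible (s : seq nat) : bool :=
  sorted ltn s && (size s <= head 0%N s)%N.

Definition schreier_enorm {R : realType} (x : nat -> R) : \bar R :=
  ereal_sup [set ((\sum_(k <- s) `|x k|)%:E) | s in [set s | schreier_admissible s]].

Definition schreier_norm {R : realType} (x : nat -> R) : R := fine (schreier_enorm x).

Definition seq_tail {R : realType} (n : nat) (x : nat -> R) : nat -> R :=
  fun k => if (k < n)%N then 0 else x k.

(* The Schreier space S, realised concretely as the closure of c00 in the
   Schreier norm inside R^nat:  ||x - P_n x||_S -> 0, where P_n x is the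
   restriction of x to its first n coordinates. *)
Definition schreier_space {R : realType} : set (nat -> R) :=
  [set x | (schreier_enorm x < +oo)%E /\
           (schreier_enorm (seq_tail n x) @[n --> \oo] --> (0%R)%:E)%E].

Definition quotient_of_schreier {R : realType} (Y : normedModType R) : Prop :=
  exists T : (nat -> R) -> Y,
    [/\ (forall (a : R) x y, schreier_space x -> schreier_space y ->
           T (fun k => a * x k + y k) = a *: T x + T y),
        (exists C : R, forall x, schreier_space x -> `|T x| <= C * schreier_norm x)
      & (forall y : Y, exists x, schreier_space x /\ T x = y)].

Definition c0_space {R : realType} : set (nat -> R) :=
  [set a | a @ \oo --> (0 : R)].

Definition sup_norm {R : realType} (a : nat -> R) : R :=
  sup (range (fun n => `|a n|)).

Definition linear_subspace {R : realType} {Y : normedModType R} (Z : set Y) : Prop :=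
  Z 0 /\ forall (a : R) x y, Z x -> Z y -> Z (a *: x + y).

Definition in_span {R : realType} {Y : normedModType R} (s : seq Y) (z : Y) : Prop :=
  exists c : seq R, size c = size s /\
    z = \sum_(i < size s) c`_i *: s`_i.

Definition infinite_dimensional {R : realType} {Y : normedModType R} (Z : set Y) : Prop :=
  forall s : seq Y, exists z, Z z /\ ~ in_span s z.

Definition contains_c0 {R : realType} {Y : normedModType R} (Z : set Y) : Prop :=
  exists J : (nat -> R) -> Y,
    [/\ (forall (a : R) u v, c0_space u -> c0_space v ->
           J (fun k => a * u k + v k) = a *: J u + J v),
        (forall u, c0_space u -> Z (J u))
      & exists m M : R, 0 < m /\
          forall u, c0_space u ->
            m * sup_norm u <= `|J u| /\ `|J u| <= M * sup_norm u].

Definition c0_saturated {R : realType} (Y : normedModType R) : Prop :=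
  forall Z : set Y, linear_subspace Z -> closed Z -> infinite_dimensional Z ->
    contains_c0 Z.

(* Main.v *)
(** Write [T] for the quotient map and [K] for its openness constant. A bounded
    linear form composed with [T] has small tails (the basis of the Schreier space
    is shrinking), hence the dual of [Y] is separable, and inside a given subspace
    [Z] one can choose finite codimensional subspaces [W_m] such that bounded
    sequences [w_m] in [W_m] are weakly null. Mazur's theorem and coordinatewise
    compactness then give a basic sequence [z_i] in [Z], sparse enough that every
    lifting [x] of a unit vector [\sum_i a_i z_i] can be cut by multipliers into
    consecutive pieces [x_i] with [T x_i] close to [a_i z_i].

    If [(z_i)] is dominated by the basis of [c_0] it is equivalent to it. Otherwise
    there are unit vectors [\sum_i a_i z_i], arbitrarily far out, with [sup |a_i|]
    arbitrarily small. A vector of Schreier norm at most [K], supported far out, has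
    at most about [K / eta] coordinates larger than [eta]; deleting the few pieces
    [x_i] that meet them gives blocks of [(z_i)] of norm at least [1/2] with bounded
    liftings of sup norm at most [eta]. In the Schreier space blocks whose sup norms
    decrease fast enough are dominated by the basis of [c_0], so these blocks of
    [(z_i)] span a copy of [c_0]. *)
Require Import Defs.
From mathcomp Require Import all_boot all_order all_algebra.
From mathcomp Require Import all_classical all_reals all_analysis.
From mathcomp Require Import ring lra zify.
Set Implicit Arguments. Unset Strict Implicit. Unset Printing Implicit Defensive.
Import Order.TTheory GRing.Theory Num.Theory.
Import numFieldNormedType.Exports.
Local Open Scope classical_set_scope.
Local Open Scope ring_scope.

(** * The Hahn-Banach and Mazur theorems, through sublinear functionals *)

Section HahnBanach.
Context {R : realType} {Y : normedModType R}.
Implicit Types (p q f : Y -> R) (G : Y -> R -> Prop).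

(** Homogeneity is stated as an inequality, the half that passes to infima at once; scaling back by
    [t^-1] gives the other half. *)
Definition sublinear q : Prop :=
  (forall x y, q (x + y) <= q x + q y) /\
  (forall (t : R) x, 0 <= t -> q (t *: x) <= t * q x).

Definition linear_form f : Prop :=
  forall (a : R) x y, f (a *: x + y) = a * f x + f y.

Lemma linear_form0 f : linear_form f -> f 0 = 0.
Proof. by move=> lf; have := lf 1 0 0; rewrite scaler0 addr0; lra. Qed.

Lemma linear_formD f u v : linear_form f -> f (u + v) = f u + f v.
Proof. by move=> lf; have := lf 1 u v; rewrite scale1r mul1r. Qed.

Lemma linear_formZ f a u : linear_form f -> f (a *: u) = a * f u.
Proof.
by move=> lf; have := lf a u 0; rewrite addr0 (linear_form0 lf) addr0.
Qed.

Lemma linear_formN f y : linear_form f -> f (- y) = - f y.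
Proof. by move=> lf; rewrite -scaleN1r linear_formZ // mulN1r. Qed.

Lemma linear_formB f u v : linear_form f -> f (u - v) = f u - f v.
Proof. by move=> lf; rewrite linear_formD // linear_formN. Qed.

Lemma linear_form_sum f J (a : nat -> R) (v : nat -> Y) : linear_form f ->
  f (\sum_(j < J) a j *: v j) = \sum_(j < J) a j * f (v j).
Proof.
move=> lf; elim: J => [|J IH]; first by rewrite !big_ord0 linear_form0.
by rewrite !big_ord_recr /= linear_formD // linear_formZ // IH.
Qed.

(** [G] is a cone in the product of [Y] and the line; a pair [G c r] encodes the constraint
    [r <= f c] to be imposed on a linear form [f]. *)
Definition convex_cone G : Prop :=
  [/\ G 0 0,
      forall c d r s, G c r -> G d s -> G (c + d) (r + s)
    & forall (t : R) c r, 0 <= t -> G c r -> G (t *: c) (t * r)].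

Lemma sublinear0 q : sublinear q -> q 0 = 0.
Proof.
case=> qD qZ; have := qD 0 0; have := qZ 0 0 (lexx _).
by rewrite scale0r addr0 mul0r; lra.
Qed.

Lemma sublinear_geN q : sublinear q -> forall x, - q (- x) <= q x.
Proof.
move=> sq x; have := sq.1 x (- x); rewrite subrr (sublinear0 sq); lra.
Qed.

Lemma sublinear_scale q : sublinear q ->
  forall (t : R) x, 0 <= t -> t * q x <= q (t *: x).
Proof.
move=> sq t x; rewrite le_eqVlt => /predU1P[<-|t0].
  by rewrite mul0r scale0r (sublinear0 sq).
have /= := sq.2 t^-1 (t *: x) (ltW _); rewrite invr_gt0 => /(_ t0).
by rewrite scalerA mulVf ?gt_eqF// scale1r mulrC ler_pdivlMr // mulrC.
Qed.

(* The infimal convolution of [q] with the cone [G]. *)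
Lemma sublinear_cone_shift q G : sublinear q -> convex_cone G ->
  (forall c r, G c r -> r <= q c) ->
  exists p, [/\ sublinear p, forall y, p y <= q y
              & forall c r, G c r -> p (- c) <= - r].
Proof.
move=> sq [G0 GD GZ] Gq.
pose E y := [set z | exists c r, G c r /\ z = q (y + c) - r].
have Elb y c r : G c r -> - q (- y) <= q (y + c) - r.
  by move=> /Gq; have := sq.1 (y + c) (- y); rewrite addrC addKr; lra.
have Einf y : has_lbound (E y).
  by exists (- q (- y)) => _ [c [r [Gcr ->]]]; exact: Elb.
have Ene y : E y !=set0 by exists (q (y + 0) - 0), 0, 0.
pose p y := inf (E y).
have ple y c r : G c r -> p y <= q (y + c) - r.
  by move=> Gcr; apply: ge_inf => //; exists c, r.
have lep y (a : R) : (forall c r, G c r -> a <= q (y + c) - r) -> a <= p y.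
  by move=> h; apply: lb_le_inf => // _ [c [r [Gcr ->]]]; exact: h.
exists p; split.
- split=> [x y|t x].
    rewrite -lerBlDr; apply: (lep) => c r Gcr.
    rewrite lerBlDr -lerBlDl; apply: (lep) => d s Gds.
    have := ple (x + y) _ _ (GD _ _ _ _ Gcr Gds).
    by rewrite addrACA; have := sq.1 (x + c) (y + d); lra.
  rewrite le_eqVlt => /predU1P[<-|t0].
    rewrite scale0r mul0r; have := ple 0 0 0 G0.
    by rewrite addr0 (sublinear0 sq) subr0.
  rewrite mulrC -ler_pdivrMr //; apply: (lep) => c r Gcr.
  rewrite ler_pdivrMr // mulrC.
  have := ple (t *: x) _ _ (GZ t _ _ (ltW t0) Gcr).
  by rewrite -scalerDr; have := sq.2 t (x + c) (ltW t0); lra.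
- by move=> y; have := ple y 0 0 G0; rewrite addr0 subr0.
- move=> c r Gcr; have := ple (- c) c r Gcr.
  by rewrite addNr (sublinear0 sq) sub0r.
Qed.

(** Zorn's lemma: the pointwise infimum of a chain is again sublinear, and it is finite since every
    sublinear functional below [q] is at least [- q (- y)] at [y]. *)
Lemma minimal_sublinear q : sublinear q ->
  exists p, [/\ sublinear p, forall y, p y <= q y
    & forall p', sublinear p' -> (forall y, p' y <= p y) -> p' = p].
Proof.
move=> sq; pose T := {p : Y -> R | sublinear p /\ forall y, p y <= q y}.
pose r (a b : T) := `[< forall y, sval b y <= sval a y >].
have [| | |A totA|[p [sp pq]] pmin] := @Zorn T r.
- by move=> a; apply/asboolP => y.
- move=> a b c /asboolP ab /asboolP bc; apply/asboolP => y.
  exact: le_trans (bc y) (ab y).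
- move=> [a Pa] [b Pb] /asboolP/= ab /asboolP/= ba; apply: eq_exist.
  by apply/funext => y; apply/eqP; rewrite eq_le ab ba.
- have [[a0 Aa0]|A0] := pselect (A !=set0); last first.
    exists (exist _ q (conj sq (fun y => lexx (q y)))) => s As.
    by exfalso; apply: A0; exists s.
  pose E y := [set sval a y | a in A].
  have Elb y : has_lbound (E y).
    exists (- q (- y)) => _ [a _ <-]; apply: le_trans (sublinear_geN (svalP a).1 y).
    by rewrite lerN2; exact: (svalP a).2.
  have Ene y : E y !=set0 by exists (sval a0 y), a0.
  pose m y := inf (E y).
  have mle y a : A a -> m y <= sval a y.
    by move=> Aa; apply: ge_inf => //; exists a.
  have lem y (z : R) : (forall a, A a -> z <= sval a y) -> z <= m y.
    by move=> h; apply: lb_le_inf => // _ [a Aa <-]; exact: h.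
  have sm : sublinear m.
    split=> [x y|t x].
      rewrite -lerBlDr; apply: (lem) => a Aa.
      rewrite lerBlDr -lerBlDl; apply: (lem) => b Ab.
      (* Of two members of the chain the smaller one serves at both [x] and [y]. *)
      have [/asboolP ab|/asboolP ba] := totA _ _ Aa Ab.
        have := mle (x + y) _ Ab; have := (svalP b).1.1 x y.
        by have := ab x; lra.
      have := mle (x + y) _ Aa; have := (svalP a).1.1 x y.
      by have := ba y; lra.
    rewrite le_eqVlt => /predU1P[<-|t0].
      rewrite scale0r mul0r; have := mle 0 _ Aa0.
      by rewrite (sublinear0 (svalP a0).1).
    rewrite mulrC -ler_pdivrMr //; apply: (lem) => a Aa.
    rewrite ler_pdivrMr // mulrC; apply: le_trans (mle _ _ Aa) _.
    exact: (svalP a).1.2 _ _ (ltW t0).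
  have mq y : m y <= q y by apply: le_trans (mle _ _ Aa0) ((svalP a0).2 y).
  by exists (exist _ m (conj sm mq)) => a Aa; apply/asboolP => y /=; exact: mle.
- exists p; split=> // p' sp' p'p.
  have p'q y : p' y <= q y by exact: le_trans (pq y).
  have := pmin (exist _ p' (conj sp' p'q)).
  by move=> /(_ (asboolT p'p))/(congr1 sval).
Qed.

(** A minimal sublinear [p] is linear: shifting it by the ray through [(a, p a)] cannot lower it, so
    [p (- a) <= - p a]. Hence [p] is odd, and oddness turns subadditivity into additivity. *)
Lemma linear_form_under_sublinear q : sublinear q ->
  exists f, linear_form f /\ forall y, f y <= q y.
Proof.
move=> /minimal_sublinear[p [sp pq pmin]]; exists p; split => //.
have pN a : p (- a) = - p a.
  pose G c r := exists2 t, 0 <= t & c = t *: a /\ r = t * p a.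
  have [||p' [sp' p'p p'N]] := @sublinear_cone_shift p G sp.
  - split; first by exists 0; rewrite // scale0r mul0r.
    + move=> _ _ _ _ [s s0 [-> ->]] [t t0 [-> ->]].
      by exists (s + t); rewrite ?addr_ge0 // scalerDl mulrDl.
    + move=> t _ _ t0 [s s0 [-> ->]].
      by exists (t * s); rewrite ?mulr_ge0 // scalerA mulrA.
  - by move=> _ _ [t t0 [-> ->]]; exact: sublinear_scale.
  have Ga : G a (p a) by exists 1; rewrite ?scale1r ?mul1r.
  have := p'N _ _ Ga; rewrite (pmin _ sp' p'p) => h.
  by have := sublinear_geN sp a; lra.
have pD x y : p (x + y) = p x + p y.
  apply/eqP; rewrite eq_le sp.1 /=.
  by have := sp.1 (x + y) (- y); rewrite addrK pN; lra.
have pZ t x : 0 <= t -> p (t *: x) = t * p x.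
  by move=> t0; apply/eqP; rewrite eq_le sp.2 //= sublinear_scale.
move=> a x y; rewrite pD; congr (_ + _).
have [a0|a0] := leP 0 a; first exact: pZ.
rewrite -[a in LHS]opprK scaleNr pN pZ; last by lra.
by rewrite mulNr opprK.
Qed.

Lemma linear_form_above_cone q G : sublinear q -> convex_cone G ->
  (forall c r, G c r -> r <= q c) ->
  exists f, [/\ linear_form f, forall y, f y <= q y
              & forall c r, G c r -> r <= f c].
Proof.
move=> sq cG Gq; have [p [sp pq pG]] := sublinear_cone_shift sq cG Gq.
have [f [lf fp]] := linear_form_under_sublinear sp.
exists f; split=> // [y|c r Gcr]; first exact: le_trans (pq y).
by have := fp (- c); have := pG c r Gcr; rewrite (linear_formN c lf); lra.
Qed.

(** This is the closed unit ball of the dual; by scaling, testing on it amounts to testing all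
    bounded forms. *)
Definition contraction_form f : Prop :=
  linear_form f /\ forall y, `|f y| <= `|y|.

Definition weakly_null (v : nat -> Y) : Prop :=
  forall f, contraction_form f -> forall e : R, 0 < e ->
    exists n, forall i, (n <= i)%N -> `|f (v i)| <= e.

(* Mazur's theorem, a convex combination being a list of pairs (weight, index). *)
Lemma weakly_null_convex (v : nat -> Y) : weakly_null v ->
  forall e : R, 0 < e -> exists s : seq (R * nat),
    [/\ forall c, c \in s -> 0 <= c.1, \sum_(c <- s) c.1 = 1
      & `|\sum_(c <- s) c.1 *: v c.2| <= e].
Proof.
move=> wv e e0; apply: contrapT => far.
(* The cone generated by the pairs [(v i, e)]. If all convex combinations have norm above [e], the
   norm dominates it, and the form obtained is at least [e] on every [v i], against weak nullity. *)
pose G c r := exists s : seq (R * nat), [/\ forall c, c \in s -> 0 <= c.1,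
  c = \sum_(c <- s) c.1 *: v c.2 & r = e * \sum_(c <- s) c.1].
have snorm : sublinear (fun y : Y => `|y|).
  by split=> [x y|t x t0]; rewrite ?ler_normD // normrZ ger0_norm.
have cG : convex_cone G.
  split; first by exists [::]; rewrite !big_nil mulr0.
  - move=> _ _ _ _ [s [s0 -> ->]] [t [t0 -> ->]]; exists (s ++ t).
    split; rewrite ?big_cat ?mulrDr // => c.
    by rewrite mem_cat => /orP[/s0|/t0].
  - move=> a _ _ a0 [s [s0 -> ->]]; exists [seq (a * c.1, c.2) | c <- s].
    split; rewrite ?big_map /=.
    + by move=> _ /mapP[c cs ->]; rewrite mulr_ge0 // s0.
    + by rewrite scaler_sumr; apply: eq_bigr => c _; rewrite scalerA.
    + by rewrite -mulr_sumr; ring.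
have Gle c r : G c r -> r <= `|c|.
  move=> [s [s0 -> ->]].
  have : 0 <= \sum_(c <- s) c.1.
    by rewrite big_seq; apply: sumr_ge0 => i /s0.
  rewrite le_eqVlt => /predU1P[<-|]; first by rewrite mulr0.
  set a := \sum_(c <- s) c.1 => a0; rewrite leNgt; apply/negP => lt.
  apply: far; exists [seq (a^-1 * c.1, c.2) | c <- s].
  split; rewrite ?big_map /=.
  - by move=> _ /mapP[d ds ->]; rewrite mulr_ge0 ?s0 // invr_ge0 ltW.
  - by rewrite -mulr_sumr mulVf // gt_eqF.
  - under eq_bigr do rewrite -scalerA.
    rewrite -scaler_sumr normrZ ger0_norm ?invr_ge0 ?(ltW a0) //.
    by rewrite ler_pdivrMl // mulrC ltW.
have [f [lf fle fG]] := linear_form_above_cone snorm cG Gle.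
have cf : contraction_form f.
  split=> // y; rewrite ler_norml fle andbT -lerN2 opprK -linear_formN //.
  by rewrite -(normrN y).
have [n /(_ n (leqnn n))] := wv f cf (e / 2) (divr_gt0 e0 (ltr0n _ 2)).
have : e <= f (v n).
  apply: fG; exists [:: (1, n)]; rewrite !big_seq1 scale1r mulr1; split => //.
  by move=> c; rewrite inE => /eqP ->.
by have := ler_norm (f (v n)); lra.
Qed.

End HahnBanach.

(** * Vectors of bounded Schreier norm *)

Section SchreierBounded.
Context {R : realType}.
Implicit Types (x y : nat -> R) (M : R).

(* Coordinates are shifted by one with respect to [schreier_admissible]: there
   no admissible set contains [0], so that the coordinate [0] is invisible. *)
Definition schreier_bounded M x : Prop :=
  forall n (s : seq nat), uniq s -> (forall k, k \in s -> (n <= k)%N) ->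
    (size s <= n.+1)%N -> \sum_(k <- s) `|x k| <= M.

Definition supported_below n x : Prop := forall k, (n <= k)%N -> x k = 0.

Definition supported_above n x : Prop := forall k, (k < n)%N -> x k = 0.

Lemma schreier_bounded_ge0 M x : schreier_bounded M x -> 0 <= M.
Proof. by move=> /(_ 0 [::]); rewrite big_nil; apply. Qed.

Lemma schreier_bounded_coord M x k : schreier_bounded M x -> `|x k| <= M.
Proof.
move=> /(_ k [:: k]); rewrite big_seq1; apply=> // j.
by rewrite inE => /eqP ->.
Qed.

Lemma schreier_bounded_le M x y : (forall k, `|x k| <= `|y k|) ->
  schreier_bounded M y -> schreier_bounded M x.
Proof.
move=> xy yM n s us sn ss; apply: le_trans (yM n s us sn ss).
exact: ler_sum.
Qed.

Lemma schreier_boundedW M M' x :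
  M <= M' -> schreier_bounded M x -> schreier_bounded M' x.
Proof. by move=> MM' xM n s us sn ss; exact: le_trans (xM n s us sn ss) MM'. Qed.

Lemma schreier_boundedD M M' x y : schreier_bounded M x ->
  schreier_bounded M' y -> schreier_bounded (M + M') (fun k => x k + y k).
Proof.
move=> xM yM n s us sn ss.
apply: le_trans (lerD (xM n s us sn ss) (yM n s us sn ss)).
by rewrite -big_split; apply: ler_sum => k _; exact: ler_normD.
Qed.

Lemma schreier_boundedZ a M x : schreier_bounded M x ->
  schreier_bounded (`|a| * M) (fun k => a * x k).
Proof.
move=> xM n s us sn ss; apply: le_trans (ler_wpM2l (normr_ge0 a) (xM n s us sn ss)).
by rewrite mulr_sumr; apply: ler_sum => k _; rewrite normrM.
Qed.

Lemma schreier_bounded0 : schreier_bounded 0 (fun=> 0).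
Proof. by move=> n s *; rewrite big1 // => k _; rewrite normr0. Qed.

Lemma schreier_bounded_unit j : schreier_bounded 1 (fun k => (k == j)%:R).
Proof.
move=> n s us _ _.
have -> : \sum_(k <- s) `|(k == j)%:R : R| = \sum_(k <- s | k == j) 1.
  by rewrite [RHS]big_mkcond; apply: eq_bigr => k _; case: eqP; rewrite ?normr1 ?normr0.
rewrite big_const_seq iter_addr_0 (count_uniq_mem _ us).
by case: (j \in s); rewrite ?mulr1n ?mulr0n.
Qed.

Definition truncate n x : nat -> R := fun k => if (k < n)%N then x k else 0.

Lemma truncateS n x : truncate n.+1 x =
  (fun k => x n * (k == n)%:R + truncate n x k).
Proof.
apply/funext => k; rewrite /truncate ltnS leq_eqVlt.
by have [->|] := eqVneq k n; rewrite ?ltnn ?mulr1 ?addr0 //= mulr0 add0r.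
Qed.

Lemma truncate_le n x k : `|truncate n x k| <= `|x k|.
Proof. by rewrite /truncate; case: ifP; rewrite ?normr0. Qed.

Lemma truncate_schreier_bounded n x : exists M, schreier_bounded M (truncate n x).
Proof.
elim: n => [|n [M IH]]; first by exists 0; exact: schreier_bounded0.
exists (`|x n| * 1 + M); rewrite truncateS.
exact/schreier_boundedD/IH/schreier_boundedZ/schreier_bounded_unit.
Qed.

Lemma truncate_supported n x : supported_below n (truncate n x).
Proof. by move=> k; rewrite /truncate ltnNge => ->. Qed.

Definition tail n x : nat -> R := fun k => x k - truncate n x k.

Lemma tail_above n x : supported_above n (tail n x).
Proof. by move=> k kn; rewrite /tail /truncate kn subrr. Qed.

Lemma tail_below n N x : supported_below N x -> supported_below N (tail n x).
Proof. by move=> xN k kN; rewrite /tail /truncate xN // if_same subr0. Qed.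

Lemma tail_bounded n M x : schreier_bounded M x -> schreier_bounded M (tail n x).
Proof.
apply: schreier_bounded_le => k; rewrite /tail /truncate.
by case: ifP; rewrite ?subrr ?normr0 ?subr0.
Qed.

End SchreierBounded.

(** * Comparison with the Schreier norm and the Schreier space *)

Section SchreierSpace.
Context {R : realType}.
Implicit Types (x y : nat -> R) (M : R).

(** Passes from the indexing of [schreier_bounded] to that of [schreier_admissible], filling the
    invisible coordinate with [0]. *)
Definition shift x : nat -> R := fun k => if k is k'.+1 then x k' else 0.

Lemma le_schreier_enorm x s : schreier_admissible s ->
  ((\sum_(k <- s) `|x k|)%:E <= schreier_enorm x)%E.
Proof. by move=> sa; apply: ereal_sup_ubound; exists s. Qed.

Lemma schreier_enorm_le x (M : \bar R) :
  (forall s, schreier_admissible s -> ((\sum_(k <- s) `|x k|)%:E <= M)%E) ->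
  (schreier_enorm x <= M)%E.
Proof. by move=> h; apply: ge_ereal_sup => _ [s sa <-]; exact: h. Qed.

Lemma schreier_enorm_ge0 x : (0 <= schreier_enorm x)%E.
Proof. by have := @le_schreier_enorm x [::] isT; rewrite big_nil. Qed.

Lemma schreier_admissible_gt0 s k : schreier_admissible s -> k \in s -> (0 < k)%N.
Proof.
case: s => // a s; rewrite /schreier_admissible /= => /andP[ps a0].
rewrite inE => /predU1P[->|ks]; first exact: leq_ltn_trans a0.
have /allP/(_ k ks) := order_path_min ltn_trans ps; exact: leq_ltn_trans.
Qed.

Lemma le_schreier_enorm_norm x y : (forall k, `|x k.+1| <= `|y k.+1|) ->
  (schreier_enorm x <= schreier_enorm y)%E.
Proof.
move=> xy; apply: schreier_enorm_le => s sa.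
apply: le_trans (le_schreier_enorm y sa); rewrite lee_fin.
rewrite big_seq [leRHS]big_seq; apply: ler_sum => k /(schreier_admissible_gt0 sa).
by case: k => // k _; exact: xy.
Qed.

(** Lowering an admissible set of minimum [a] by one gives a set of minimum [a.-1] and of size at
    most [a.-1.+1], as tested by [schreier_bounded]. *)
Lemma schreier_enorm_shift M x : schreier_bounded M x ->
  (schreier_enorm (shift x) <= M%:E)%E.
Proof.
move=> xM; apply: schreier_enorm_le => s sa; rewrite lee_fin.
have s0 k : k \in s -> k = k.-1.+1.
  by move=> /(schreier_admissible_gt0 sa) k0; rewrite prednK.
have -> : \sum_(k <- s) `|shift x k| = \sum_(k <- map predn s) `|x k|.
  by rewrite big_map big_seq [RHS]big_seq; apply: eq_bigr => k /s0 ->.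
case: s => [|a s] in sa s0 *; first by have := xM 0 [::]; rewrite !big_nil; exact.
move: (sa) => /andP[ss sa0]; apply: (xM a.-1).
- rewrite map_inj_in_uniq ?(sorted_uniq ltn_trans ltnn) //.
  by move=> j k /s0 -> /s0 -> /= ->.
- move=> _ /mapP[k ks ->]; move: ks; rewrite inE => /predU1P[-> //|ks].
  have /allP/(_ k ks) := order_path_min ltn_trans ss; lia.
- by rewrite size_map; move: sa0 => /=; lia.
Qed.

Lemma schreier_bounded_unshift M x : (schreier_enorm x <= M%:E)%E ->
  schreier_bounded M (fun k => x k.+1).
Proof.
move=> xM n s us sn ss; rewrite -lee_fin; apply: le_trans xM.
(* [schreier_bounded] tests unordered lists, so the raised list has to be sorted before it is
   admissible. *)
pose s' := sort leq (map S s).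
have us' : uniq s' by rewrite sort_uniq map_inj_uniq // => j k [].
have -> : \sum_(k <- s) `|x k.+1| = \sum_(k <- s') `|x k|.
  by rewrite (perm_big _ (permEl (perm_sort _ _))) big_map.
apply: le_schreier_enorm; rewrite /schreier_admissible ltn_sorted_uniq_leq us'.
rewrite sort_sorted; last exact: leq_total.
rewrite /= size_sort size_map.
have s'n k : k \in s' -> (n < k)%N by rewrite mem_sort => /mapP[j /sn jn ->].
have : size s' = size s by rewrite size_sort size_map.
case: s' s'n {us'} => [|a s'] s'n /= sz; first by rewrite -sz.
exact: leq_trans ss (s'n a (mem_head _ _)).
Qed.

Lemma schreier_space_le x y : (forall k, `|x k.+1| <= `|y k.+1|) ->
  schreier_space y -> schreier_space x.
Proof.
move=> xy [y1 y2]; split; first exact: le_lt_trans (le_schreier_enorm_norm xy) y1.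
apply: squeeze_cvge (cvg_cst _) y2; apply: nearW => n.
rewrite schreier_enorm_ge0 /=; apply: le_schreier_enorm_norm => k.
by rewrite /seq_tail; case: ifP; rewrite ?normr0.
Qed.

Lemma schreier_space_shift n x : schreier_space (shift (truncate n x)).
Proof.
split.
  have [M /schreier_enorm_shift xM] := truncate_schreier_bounded n x.
  exact: le_lt_trans xM (ltry _).
apply: cvg_near_cst; near=> N.
apply/eqP; rewrite eq_le schreier_enorm_ge0 andbT.
apply: schreier_enorm_le => s _; rewrite big1 // => -[|k] _.
  by rewrite /seq_tail; case: ifP; rewrite normr0.
rewrite /seq_tail /= /truncate; case: ifP => [|kN]; first by rewrite normr0.
case: ifP => kn; last by rewrite normr0.
have : (n < N)%N by near: N; exact: nbhs_infty_gt.
by move: kN kn; lia.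
Unshelve. all: by end_near. Qed.

Lemma schreier_norm_le M x : (schreier_enorm x <= M%:E)%E -> schreier_norm x <= M.
Proof.
rewrite /schreier_norm; have := schreier_enorm_ge0 x.
by case: (schreier_enorm x) => [r| |] //=; rewrite lee_fin.
Qed.

Lemma schreier_norm_ge0 x : 0 <= schreier_norm x.
Proof. exact: fine_ge0 (schreier_enorm_ge0 x). Qed.

End SchreierSpace.

(** * Finite linear combinations; with the images [t k] of the unit vectors, the quotient map on
    finitely supported vectors *)

Definition synthesis {R : realType} {Y : normedModType R} (t : nat -> Y) n
  (x : nat -> R) : Y := \sum_(k < n) x k *: t k.

Section Synthesis.
Context {R : realType} {Y : normedModType R} (t : nat -> Y).
Implicit Types x y : nat -> R.

Lemma synthesis_widen n m x : (n <= m)%N -> supported_below n x ->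
  synthesis t m x = synthesis t n x.
Proof.
move=> nm xn; rewrite /synthesis [RHS](big_ord_widen m (fun k => x k *: t k)) //.
rewrite [RHS]big_mkcond; apply: eq_bigr => k _; case: ltnP => // nk.
by rewrite xn // scale0r.
Qed.

Lemma synthesis_lin n a x y :
  synthesis t n (fun k => a * x k + y k) = a *: synthesis t n x + synthesis t n y.
Proof.
rewrite /synthesis scaler_sumr -big_split; apply: eq_bigr => k _.
by rewrite scalerDl scalerA.
Qed.

Lemma synthesisB n x y :
  synthesis t n (fun k => x k - y k) = synthesis t n x - synthesis t n y.
Proof. by rewrite /synthesis -sumrB; apply: eq_bigr => k _; rewrite scalerBl. Qed.

Lemma synthesis0 n : synthesis t n (fun=> 0) = 0.
Proof. by rewrite /synthesis big1 // => k _; rewrite scale0r. Qed.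

Lemma synthesis_sum n J (a : nat -> R) (g : nat -> nat -> R) :
  synthesis t n (fun k => \sum_(j < J) a j * g j k) =
  \sum_(j < J) a j *: synthesis t n (g j).
Proof.
rewrite /synthesis; under eq_bigr do rewrite scaler_suml.
rewrite exchange_big; apply: eq_bigr => j _; rewrite scaler_sumr.
by apply: eq_bigr => k _; rewrite scalerA.
Qed.

Lemma synthesis_truncate n x : synthesis t n (truncate n x) = synthesis t n x.
Proof. by apply: eq_bigr => k _; rewrite /truncate ltn_ord. Qed.

Lemma synthesisS n x : synthesis t n.+1 x = synthesis t n x + x n *: t n.
Proof. by rewrite /synthesis big_ord_recr. Qed.

Lemma synthesis_split n N x : (n <= N)%N ->
  synthesis t N x = synthesis t n x + synthesis t N (tail n x).
Proof.
move=> nN; rewrite /tail synthesisB.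
rewrite (synthesis_widen nN (@truncate_supported _ n x)) synthesis_truncate.
by rewrite addrC subrK.
Qed.

End Synthesis.

(** * Approximate liftings through the quotient map, by Baire's theorem *)

Section Quotient.
Context {R : realType} {Y : completeNormedModType R}.

Lemma nat_bound (r : R) : exists n : nat, r <= n%:R.
Proof.
exists (Num.truncn `|r|).+1; apply: le_trans (ler_norm r) (ltW _).
exact: truncnS_gt.
Qed.

(* Baire's theorem yields liftings only up to an arbitrarily small error, but
   then with finitely supported vectors. *)
Lemma quotient_representation : quotient_of_schreier Y ->
  exists (t : nat -> Y) (C K : R), [/\ 0 < K,
    forall n x M, schreier_bounded M x -> `|synthesis t n x| <= C * M
  & forall y (e : R), 0 < e -> exists n x, [/\ supported_below n x,
      schreier_bounded (K * `|y|) x & `|synthesis t n x - y| <= e]].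
Proof.
move=> [T [linT [C0 TC0] Tsurj]].
pose C := `|C0| + 1.
have C_gt0 : 0 < C by rewrite ltr_wpDl.
have TC x : schreier_space x -> `|T x| <= C * schreier_norm x.
  move=> /TC0 h; apply: le_trans h _; rewrite ler_wpM2r ?schreier_norm_ge0 //.
  by rewrite /C; have := ler_norm C0; lra.
(* The image of the [k]-th unit vector, truncated so that [schreier_space_shift] applies. *)
pose t k := T (shift (truncate k.+1 (fun j => (j == k)%:R))).
have tE n x : T (shift (truncate n x)) = synthesis t n x.
  elim: n => [|n IH].
    rewrite /synthesis big_ord0.
    have := linT 1 _ _ (schreier_space_shift 0 x) (schreier_space_shift 0 x).
    have -> : (fun k => 1 * shift (truncate 0 x) k + shift (truncate 0 x) k) =
              shift (truncate 0 x).
      by apply/funext => -[|k] //=; rewrite /truncate /= ?mul1r addr0.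
    by rewrite scale1r => /eqP; rewrite -subr_eq subrr eq_sym => /eqP.
  rewrite /synthesis big_ord_recr /= addrC -[in RHS]/(synthesis t n x) -IH.
  rewrite -linT //; try exact: schreier_space_shift.
  congr T; apply/funext => -[|k] /=; first by rewrite mulr0 addr0.
  rewrite truncateS /=; congr (_ * _ + _); rewrite /truncate ltnS.
  by case: leqP => // kn; rewrite gtn_eqF.
have synC n x M : schreier_bounded M x -> `|synthesis t n x| <= C * M.
  move=> xM; rewrite -tE; apply: le_trans (TC _ (schreier_space_shift n x)) _.
  rewrite ler_pM2l //; apply/schreier_norm_le/schreier_enorm_shift.
  exact: schreier_bounded_le (truncate_le n x) xM.
(* Since finitely supported vectors are dense, the closures of the [A i] cover [Y], and one of them
   contains a ball. *)
pose A (i : nat) : set Y := [set y | exists n x, [/\ supported_below n x,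
  schreier_bounded i%:R x & y = synthesis t n x]].
have cover y : exists i, closure (A i) y.
  have [x [Sx <-]] := Tsurj y.
  have [x1 x2] := Sx.
  have [i xi] : exists i : nat, (schreier_enorm x <= i%:R%:E)%E.
    move: x1; have := schreier_enorm_ge0 x.
    case: (schreier_enorm x) => // r _ _.
    by have [i ri] := nat_bound r; exists i; rewrite lee_fin.
  exists i => B /nbhs_ballP[e /= e0 Be].
  have eC0 : 0 < e / (2 * C) by rewrite divr_gt0 // mulr_gt0.
  have [n xn] : exists n, (schreier_enorm (seq_tail n.+1 x) <= (e / (2 * C))%:E)%E.
    have [fin_x /cvgr0Pnorm_le/(_ _ eC0) small_x] := (fine_cvgP _ _).1 x2.
    have [N _ hN] := filterI fin_x small_x; exists N.
    have [fin_N /= le_N] := hN N.+1 (leqnSn N).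
    by rewrite -(fineK fin_N) lee_fin; apply: le_trans (ler_norm _) le_N.
  pose x' k := x k.+1.
  exists (synthesis t n (truncate n x')); split.
    exists n, (truncate n x'); split => //; first exact: truncate_supported.
    apply: schreier_bounded_le (truncate_le n x') _.
    exact: schreier_bounded_unshift.
  apply: Be; rewrite -ball_normE /ball_ /=.
  rewrite synthesis_truncate -tE.
  have -> : T x - T (shift (truncate n x')) =
            T (fun k => (-1) * shift (truncate n x') k + x k).
    by rewrite linT // ?scaleN1r 1?addrC //; exact: schreier_space_shift.
  set d := (fun k => _).
  have dx k : `|d k.+1| <= `|seq_tail n.+1 x k.+1|.
    rewrite /d /= /truncate /seq_tail /x' ltnS; case: ifP => _.
      by rewrite mulN1r addNr.
    by rewrite mulr0 add0r.
  have Sd : schreier_space d.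
    apply: schreier_space_le Sx => k; apply: le_trans (dx k) _.
    by rewrite /seq_tail; case: ifP; rewrite ?normr0.
  apply: le_lt_trans (TC _ Sd) _.
  have /schreier_norm_le : (schreier_enorm d <= (e / (2 * C))%:E)%E.
    exact: le_trans (le_schreier_enorm_norm dx) xn.
  rewrite -(ler_pM2l C_gt0) => /le_lt_trans; apply.
  have -> : C * (e / (2 * C)) = e / 2 by field; rewrite gt_eqF.
  by lra.
have [i [y0 [r r0 ball_A]]] : exists i y0, exists2 r : R, 0 < r &
    forall h : Y, `|h| < r -> closure (A i) (y0 + h).
  apply: contrapT => no.
  have dns i : open (~` closure (A i)) /\ dense (~` closure (A i)).
    split; first by apply: closed_openC; exact: closed_closure.
    move=> O [y0 Oy0] oO; apply: contrapT => OA; apply: no.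
    have /nbhs_ballP[r /= r0 Or] : nbhs y0 O by exact: open_nbhs_nbhs.
    exists i, y0, r => // h hr; apply: contrapT => nA; apply: OA.
    exists (y0 + h); split => //; apply: Or.
    by rewrite -ball_normE /ball_ /= opprD addNKr normrN.
  have [|y [_ yA]] := @Baire R Y _ dns setT _ openT; first by exists 0.
  by have [i] := cover y; exact: (yA i I).
(* A vector [y] is [c^-1] times the difference of [y0 + c *: y] and [y0], with [c = r / 2 / |y|].
   Both have approximate liftings bounded by [i], which gives the bound [2 i / c = 4 i |y| / r]; the
   summand [1] makes [K] positive. *)
pose K := 4 * i%:R / r + 1.
have K_gt0 : 0 < K by rewrite ltr_wpDl // divr_ge0 ?mulr_ge0 // ltW.
exists t, C, K; split=> // y e e0.
have approx z (e' : R) : 0 < e' -> closure (A i) z ->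
    exists n x, [/\ supported_below n x,
      schreier_bounded i%:R x & `|synthesis t n x - z| <= e'].
  move=> e'0 /(_ _ (nbhsx_ballx z _ e'0))[_ [[n [x [xn xi ->]]]]].
  by rewrite -ball_normE /ball_ /= distrC => /ltW h; exists n, x.
have [y_0|yn0] := eqVneq y 0.
  exists 0, (fun=> 0); split => //.
    apply: schreier_boundedW schreier_bounded0.
    by rewrite mulr_ge0 // ltW.
  by rewrite /synthesis big_ord0 y_0 subr0 normr0 ltW.
have ny0 : 0 < `|y| by rewrite normr_gt0.
pose c := r / 2 / `|y|.
have c0 : 0 < c by rewrite !divr_gt0.
(* Two such errors, divided by [c], add up to [e]. *)
have ce0 : 0 < c * e / 2 by rewrite divr_gt0 // mulr_gt0.
have ch : `|c *: y| < r.
  by rewrite normrZ gtr0_norm // /c divfK ?gt_eqF //; lra.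
have [n1 [x1 [s1 b1 a1]]] := approx _ _ ce0 (ball_A _ ch).
have A0 : closure (A i) y0 by have := ball_A 0; rewrite addr0; apply; rewrite normr0.
have [n2 [x2 [s2 b2 a2]]] := approx _ _ ce0 A0.
pose x k := c^-1 * (x1 k + (-1) * x2 k).
exists (maxn n1 n2), x; split.
- move=> k; rewrite geq_max => /andP[k1 k2].
  by rewrite /x s1 // s2 // mulr0 addr0 mulr0.
- apply: schreier_boundedW (schreier_boundedZ _ (schreier_boundedD b1
    (schreier_boundedZ _ b2))).
  rewrite gtr0_norm ?invr_gt0 // normrN1 mul1r /K /c.
  have -> : (r / 2 / `|y|)^-1 * (i%:R + i%:R) = 4 * i%:R / r * `|y|.
    by field; rewrite gt_eqF // gt_eqF.
  by rewrite [leRHS]mulrDl mul1r lerDl.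
have -> : synthesis t (maxn n1 n2) x = c^-1 *: (synthesis t n1 x1 - synthesis t n2 x2).
  rewrite -(synthesis_widen t (leq_maxl n1 n2) s1).
  rewrite -(synthesis_widen t (leq_maxr n1 n2) s2).
  rewrite /synthesis -sumrB scaler_sumr; apply: eq_bigr => k _.
  by rewrite /x mulN1r -scalerBl scalerA.
have -> : c^-1 *: (synthesis t n1 x1 - synthesis t n2 x2) - y =
  c^-1 *: ((synthesis t n1 x1 - (y0 + c *: y)) - (synthesis t n2 x2 - y0)).
  rewrite opprB opprD [- y0 - _]addrC !addrA subrK addrAC [RHS]scalerBr scalerA.
  by rewrite mulVf ?gt_eqF // scale1r.
rewrite normrZ gtr0_norm ?invr_gt0 // ler_pdivrMl //.
apply: le_trans (ler_normB _ _) _; apply: le_trans (lerD a1 a2) _.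
by rewrite -splitr.
Qed.

End Quotient.

(** * Block sequences in the Schreier space *)

Section Blocks.
Context {R : realType}.
Implicit Types (x y : nat -> R) (M : R).

(** Dependent choice for blocks: each stage starts at the index where the previous one ended. *)
Lemma sequential_choice (A : Type) (P : nat -> nat -> nat -> A -> Prop) :
  (forall j n, exists N a, P j n N a) ->
  forall n0, exists (s : nat -> nat) (a : nat -> A),
    s 0%N = n0 /\ forall j, P j (s j) (s j.+1) (a j).
Proof.
move=> h n0.
have /choice[F FP] : forall jn : nat * nat, exists Na : nat * A,
    P jn.1 jn.2 Na.1 Na.2.
  by move=> [j n]; have [N [a Pa]] := h j n; exists (N, a).
pose s := fix s j := if j is j'.+1 then (F (j', s j')).1 else n0.
by exists s, (fun j => (F (j, s j)).2); split=> // j; exact: (FP (j, s j)).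
Qed.

(** A test set starting at [n] has at most [n.+1] elements, so the errors [M / n.+1] add up to at
    most [M]. *)
Lemma schreier_bounded_head M x :
  (forall n, exists2 g, schreier_bounded M g &
     forall k, (n <= k)%N -> `|x k| <= `|g k| + M / n.+1%:R) ->
  schreier_bounded (M + M) x.
Proof.
move=> h n s us sn ss; have [g gM xg] := h n.
have M0 := schreier_bounded_ge0 gM.
apply: (@le_trans _ _ (\sum_(k <- s) (`|g k| + M / n.+1%:R))).
  by rewrite big_seq [leRHS]big_seq; apply: ler_sum => k /sn /xg.
rewrite big_split /=; apply: lerD; first exact: gM us sn ss.
rewrite big_const_seq iter_addr_0 count_predT.
rewrite -[_ *+ size s]mulr_natl mulrA ler_pdivrMr ?ltr0n // mulrC ler_wpM2l //.
by rewrite ler_nat.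
Qed.

Lemma block_sum_coord (g : nat -> nat -> R) (s : nat -> nat) :
  (forall j, (s j <= s j.+1)%N) ->
  (forall j, supported_above (s j) (g j) /\ supported_below (s j.+1) (g j)) ->
  forall (a : nat -> R) J k, \sum_(j < J) a j * g j k = 0 \/
    exists i, [/\ (i < J)%N, (s i <= k < s i.+1)%N
                & \sum_(j < J) a j * g j k = a i * g i k].
Proof.
move=> s_mono gs a J k.
have [[i iJ gi]|no] := pselect (exists2 i, (i < J)%N & g i k != 0); last first.
  left; rewrite big1 // => j _; have [->|gj] := eqVneq (g j k) 0.
    by rewrite mulr0.
  by exfalso; apply: no; exists j.
right; exists i.
have inb j : g j k != 0 -> (s j <= k < s j.+1)%N.
  move=> gj; have [ga gb] := gs j; apply/andP; split; rewrite leqNgt; apply/negP.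
    by move=> /ga/eqP; rewrite (negbTE gj).
  by rewrite ltnS => /gb/eqP; rewrite (negbTE gj).
split=> //; first exact: inb.
rewrite (bigD1 (Ordinal iJ)) //= big1 ?addr0 // => j ji.
have [->|/inb /andP[j1 j2]] := eqVneq (g j k) 0; first by rewrite mulr0.
have /andP[i1 i2] := inb _ gi.
have mono : {homo s : m n / (m <= n)%N} := homo_leq (@leqnn) leq_trans s_mono.
have : nat_of_ord j <> i by move=> eji; move: ji; rewrite -val_eqE /= eji eqxx.
have [/mono|/mono|//] := ltngtP (nat_of_ord j) i; lia.
Qed.

(** The upper [c_0] estimate. Let [j] be the first block ending past [n]. Beyond [n] the sum
    consists of this block, bounded by [M], and of later blocks [l], where [n < s l] makes the
    coordinates at most [M / n.+1]; then [schreier_bounded_head] applies. *)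
Lemma schreier_bounded_blocks M (g : nat -> nat -> R) (s : nat -> nat) :
  (forall j, (s j <= s j.+1)%N) ->
  (forall j, supported_above (s j) (g j) /\ supported_below (s j.+1) (g j)) ->
  (forall j, schreier_bounded M (g j)) ->
  (forall j k, `|g j k| <= M / (s j).+1%:R) ->
  forall (a : nat -> R) B J, (forall j, (j < J)%N -> `|a j| <= B) -> 0 <= B ->
    schreier_bounded (B * (M + M)) (fun k => \sum_(j < J) a j * g j k).
Proof.
move=> s_mono gs gM g_small a B J aB B0.
have M0 : 0 <= M := schreier_bounded_ge0 (gM 0).
have mono : {homo s : m n / (m <= n)%N} := homo_leq (@leqnn) leq_trans s_mono.
rewrite mulrDr; apply: schreier_bounded_head => n.
have coord k : `|\sum_(j < J) a j * g j k| = 0 \/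
    exists2 i, (s i <= k < s i.+1)%N & `|\sum_(j < J) a j * g j k| <= B * `|g i k|.
  have [->|[i [iJ ik ->]]] := block_sum_coord s_mono gs a J k.
    by left; rewrite normr0.
  by right; exists i => //; rewrite normrM ler_wpM2r // aB.
have rhs0 : 0 <= B * M / n.+1%:R by rewrite divr_ge0 ?mulr_ge0.
(* As [s] is only nondecreasing, all blocks may end by [n]; the sum then vanishes from [n] on. *)
have [[i ni]|no] := pselect (exists i, (n < s i.+1)%N); last first.
  exists (fun=> 0).
    by apply: schreier_boundedW schreier_bounded0; exact: mulr_ge0.
  move=> k nk; rewrite normr0 add0r; have [->//|[i /andP[_ ki] _]] := coord k.
  by exfalso; apply: no; exists i; exact: leq_ltn_trans ki.
have [j nj jmin] := ex_minnP (ex_intro (fun i => (n < s i.+1)%N) i ni).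
exists (fun k => B * g j k).
  by have := schreier_boundedZ B (gM j); rewrite ger0_norm.
move=> k nk; rewrite normrM (ger0_norm B0).
have [->|[l /andP[l1 l2] le_l]] := coord k; first by rewrite addr_ge0 ?mulr_ge0.
have jl : (j <= l)%N by apply: jmin; exact: leq_ltn_trans l2.
move: jl; rewrite leq_eqVlt => /predU1P[->|jl].
  by apply: le_trans le_l _; rewrite lerDl.
apply: le_trans le_l _; apply: (@le_trans _ _ (B * M / n.+1%:R)); last first.
  by rewrite lerDr mulr_ge0.
rewrite -mulrA ler_wpM2l //; apply: le_trans (g_small _ _) _.
rewrite ler_wpM2l // lef_pV2 ?posrE ?ltr0n // ler_nat ltnS.
by have := mono _ _ jl; move: nj; lia.
Qed.

End Blocks.

(** * Small tails of composed forms, and separability of the dual *)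

Section Shrinking.
Context {R : realType} {Y : normedModType R} (t : nat -> Y) (C K : R).
Context (synC : forall n x M, schreier_bounded M x -> `|synthesis t n x| <= C * M).
Implicit Types (x y : nat -> R) (f : Y -> R).

(** In other words, [f o T] has norm at most [e] on the finitely supported vectors that live past
    [n]. *)
Definition small_tail f n (e : R) : Prop := forall M x N, schreier_bounded M x ->
  supported_above n x -> supported_below N x -> `|f (synthesis t N x)| <= e * M.

(* A block sequence on which [f o T] does not tend to [0] can be averaged to one
   whose sup norms decay so fast that all its partial sums are bounded. *)
Lemma shrinking f : contraction_form f ->
  forall e : R, 0 < e -> exists n, small_tail f n e.
Proof.
move=> [lf f1] e e0; apply: contrapT => no.
have step1 (j n : nat) : exists N x, [/\ (n <= N)%N, schreier_bounded 1 x,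
    supported_above n x, supported_below N x & e < f (synthesis t N x)].
  have [M [x [N0 [xM xn xN0 big]]]] : exists M x N, [/\ schreier_bounded M x,
     supported_above n x, supported_below N x & e * M < `|f (synthesis t N x)|].
    apply: contrapT => nn; apply: no; exists n => M x N xM xn xN.
    by rewrite leNgt; apply/negP => lt; apply: nn; exists M, x, N.
  have M0 : 0 < M.
    (* If [M] were [0], the bound [C * M] would make the image of [x] vanish. *)
    rewrite lt_neqAle (schreier_bounded_ge0 xM) andbT eq_sym.
    apply/eqP => M0; move: big; rewrite ltNge M0 mulr0 => /negP; apply.
    by apply: le_trans (f1 _) _; have := synC N0 xM; rewrite M0 mulr0.
  pose N := maxn n N0.
  have xN : supported_below N x by move=> k; rewrite geq_max => /andP[_ /xN0].
  rewrite -(synthesis_widen t (leq_maxr n N0) xN0) -/N in big.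
  pose c := (if 0 <= f (synthesis t N x) then 1 else -1) / M.
  have fc : f (synthesis t N (fun k => c * x k + 0)) = `|f (synthesis t N x)| / M.
    rewrite synthesis_lin synthesis0 addr0 linear_formZ // /c.
    by case: (lerP 0 (f _)) => [/ger0_norm ->|/ltr0_norm ->]; field; rewrite gt_eqF.
  exists N, (fun k => c * x k + 0); split.
  - exact: leq_maxl.
  - have := schreier_boundedD (schreier_boundedZ c xM) schreier_bounded0.
    have -> // : `|c| * M + 0 = 1.
    rewrite /c normrM (gtr0_norm (_ : 0 < M^-1)) ?invr_gt0 //.
    by case: ifP => _; rewrite ?normrN1 ?normr1 addr0 mul1r mulVf // gt_eqF.
  - by move=> k kn; rewrite xn // mulr0 addr0.
  - by move=> k kn; rewrite xN // mulr0 addr0.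
  - by rewrite fc ltr_pdivlMr.
(* The average of [n.+1] successive blocks from [step1]: the value of [f] stays above [e], while the
   coordinates drop to [1 / n.+1], the decay that [schreier_bounded_blocks] requires of a block
   starting at [n]. *)
have step2 (j n : nat) : exists N x, [/\ (n <= N)%N, schreier_bounded 1 x,
    supported_above n x /\ supported_below N x, forall k, `|x k| <= 1 / n.+1%:R
  & e < f (synthesis t N x)].
  have [s [g [s0 gP]]] := sequential_choice step1 n.
  have s_mono j' : (s j' <= s j'.+1)%N by have [] := gP j'.
  have gs j' : supported_above (s j') (g j') /\ supported_below (s j'.+1) (g j').
    by have [] := gP j'.
  have mono : {homo s : m n / (m <= n)%N} := homo_leq (@leqnn) leq_trans s_mono.
  pose a (_ : nat) : R := 1 / n.+1%:R.
  have a0 : 0 <= 1 / n.+1%:R :> R by rewrite divr_ge0.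
  exists (s n.+1), (fun k => \sum_(j < n.+1) a j * g j k); split.
  - by rewrite -s0; exact: mono.
  - have -> : 1 = \sum_(j < n.+1) 1 / n.+1%:R :> R.
      by rewrite sumr_const card_ord -[RHS]mulr_natl div1r divff.
    suff : forall m, schreier_bounded (\sum_(j < m) 1 / n.+1%:R)
      (fun k => \sum_(j < m) a j * g j k) by exact.
    elim=> [|m IH].
      rewrite big_ord0; apply: schreier_bounded_le schreier_bounded0 => k.
      by rewrite big_ord0.
    rewrite big_ord_recr /=; have [_ gm _ _ _] := gP m.
    have := schreier_boundedD IH (schreier_boundedZ (1 / n.+1%:R) gm).
    rewrite (ger0_norm a0) mulr1; apply: schreier_bounded_le => k.
    by rewrite big_ord_recr.
  - split=> k kn.
      rewrite big1 // => j' _; rewrite (gs j').1 ?mulr0 //.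
      by apply: leq_trans kn _; have := mono _ _ (leq0n j'); rewrite s0.
    rewrite big1 // => j' _; rewrite (gs j').2 ?mulr0 //.
    by apply: leq_trans kn; exact: mono.
  - move=> k; have [->|[i [_ _ ->]]] := block_sum_coord s_mono gs a n.+1 k.
      by rewrite normr0.
    rewrite normrM (ger0_norm a0) ler_piMr //; have [_ gi _ _ _] := gP i.
    exact: schreier_bounded_coord.
  - rewrite synthesis_sum.
    rewrite (linear_form_sum _ a (fun j => synthesis t (s n.+1) (g j)) lf).
    have -> : e = \sum_(j < n.+1) 1 / n.+1%:R * e.
      by rewrite sumr_const card_ord -[RHS]mulr_natl div1r mulVKf ?pnatr_eq0.
    apply: ltr_sum => [|j' _]; first by apply/hasP; exists ord0; rewrite ?mem_index_enum.
    rewrite ltr_pM2l ?divr_gt0 //; have [_ _ _ gb] := gP j'.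
    by rewrite (synthesis_widen t (mono _ _ (ltn_ord j')) gb).
have [s [g [_ gP]]] := sequential_choice step2 0.
have s_mono j : (s j <= s j.+1)%N by have [] := gP j.
have gs j : supported_above (s j) (g j) /\ supported_below (s j.+1) (g j).
  by have [] := gP j.
have mono : {homo s : m n / (m <= n)%N} := homo_leq (@leqnn) leq_trans s_mono.
(* The sum of [J.+1] averaged blocks is Schreier bounded by [2], yet [f] exceeds [e * J >= 2 * C] on
   its image. *)
have [J CJ] := nat_bound (C * (1 * (1 + 1)) / e).
have : schreier_bounded (1 * (1 + 1)) (fun k => \sum_(j < J.+1) 1 * g j k).
  apply: (@schreier_bounded_blocks _ 1 g s _ _ _ _ (fun=> 1)) => // [j|j|j _].
  - by have [] := gP j.
  - by have [] := gP j.
  - by rewrite normr1.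
move=> /(@synC (s J.+1)) le_C.
have := le_trans (le_trans (ler_norm _) (f1 _)) le_C.
rewrite (synthesis_sum t _ _ (fun=> 1)) (linear_form_sum _ (fun=> 1)
  (fun j => synthesis t (s J.+1) (g j)) lf).
apply/negP; rewrite -ltNge; rewrite ler_pdivrMr // in CJ.
apply: le_lt_trans CJ _; rewrite mulrC.
apply: (@lt_le_trans _ _ (e * J.+1%:R)).
  by rewrite ltr_pM2l // ltr_nat.
have -> : e * J.+1%:R = \sum_(j < J.+1) e by rewrite sumr_const card_ord mulr_natr.
apply: ler_sum => j _.
have [_ _ [_ gb] _ /ltW] := gP j.
by rewrite mul1r (synthesis_widen t (mono _ _ (ltn_ord j)) gb).
Qed.

Context (lift : forall (y : Y) (e : R), 0 < e -> exists n x, [/\ supported_below n x,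
  schreier_bounded (K * `|y|) x & `|synthesis t n x - y| <= e]).

Lemma rat_approx (r e : R) : 0 < e -> exists q : rat, `|r - ratr q| <= e.
Proof.
move=> e0; have [|q] := @rat_in_itvoo R (r - e) (r + e); first by lra.
rewrite in_itv /= => /andP[q1 q2]; exists q; rewrite ler_norml; lra.
Qed.

Lemma dist_split (a b a1 a2 b1 b2 e1 e2 e3 : R) :
  `|a - (a1 + a2)| <= e1 -> `|b - (b1 + b2)| <= e1 -> `|a1 - b1| <= e2 ->
  `|a2| <= e3 -> `|b2| <= e3 -> `|a - b| <= e1 + e1 + e2 + e3 + e3.
Proof.
rewrite !ler_norml.
by move=> /andP[? ?] /andP[? ?] /andP[? ?] /andP[? ?] /andP[? ?]; lra.
Qed.

(** Up to a small error a form is determined by rational approximations of its values on finitely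
    many [t i], once its tail is small. There are countably many such codes, and [phi] picks one
    form for each code that occurs. *)
Lemma separable_dual : exists phi : nat -> Y -> R,
  (forall m, contraction_form (phi m)) /\
  forall f, contraction_form f -> forall e : R, 0 < e ->
    exists m, forall y : Y, `|f y - phi m y| <= e * `|y|.
Proof.
(* In a code, [c.1.1] is the cutting index, [c.1.2] lists the approximate values and [c.2] sets the
   precision. *)
pose P (c : nat * seq rat * nat) f := [/\ contraction_form f,
  forall i, (i < c.1.1)%N ->
    `|f (t i) - ratr (nth 0 c.1.2 i)| <= c.2.+1%:R^-1 / c.1.1.+1%:R
  & small_tail f c.1.1 c.2.+1%:R^-1].
have zero_form : contraction_form (fun _ : Y => 0 : R).
  by split=> [a x y|y]; rewrite ?mulr0 ?addr0 // normr0.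
have /choice[phi phiP] : forall m : nat, exists f, contraction_form f /\
    forall c, unpickle m = Some c -> (exists f', P c f') -> P c f.
  move=> m; case E : (unpickle m) => [c|]; last by exists (fun=> 0); split.
  have [[f' Pf']|no] := pselect (exists f', P c f').
    exists f'; split; first by have [] := Pf'.
    by move=> _ [<-] _.
  by exists (fun=> 0); split=> // _ [<-].
exists phi; split=> [m|f cf e e0]; first by have [] := phiP m.
(* With [d = 1 / p.+1], two forms of the same code differ on a lifting by [2 * d * M] on the first
   [n] coordinates and by [d * M] for each of the two tails, where [M = K * |y|]; hence the factor
   [4]. *)
have [p pe] := nat_bound (4 * K / e).
have d0 : 0 < p.+1%:R^-1 :> R by rewrite invr_gt0 ltr0n.
have [n fn] := shrinking cf d0.
have dn0 : 0 < p.+1%:R^-1 / n.+1%:R :> R by rewrite divr_gt0.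
have /choice[q qP] := fun i => rat_approx (f (t i)) dn0.
pose c : nat * seq rat * nat := (n, mkseq q n, p).
exists (pickle c) => y; set h := phi (pickle c).
have Pf : P c f.
  by split=> //= i ilt; rewrite nth_mkseq.
have [ch hq hn] : P c h.
  by have [_] := phiP (pickle c); apply; [exact: pickleK|exists f].
have lf := cf.1; have lh := ch.1.
set d : R := p.+1%:R^-1 in d0 fn dn0 hn hq Pf qP.
have de : 4 * K * d <= e.
  rewrite /d ler_pdivrMr ?ltr0n // -ler_pdivrMl // mulrC.
  by apply: le_trans pe _; rewrite ler_nat.
apply/ler_addgt0Pr => eta eta0.
have [N0 [x [xN0 xM xy]]] := lift y (divr_gt0 eta0 (ltr0n R 2)).
pose N := (n + N0)%N.
have xN : supported_below N x by move=> k kN; apply: xN0; move: kN; rewrite /N; lia.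
rewrite -(synthesis_widen t (leq_addl n N0) xN0) -/N in xy.
set M := K * `|y| in xM.
have M0 : 0 <= M := schreier_bounded_ge0 xM.
have hy1 : `|f y - f (synthesis t N x)| <= eta / 2.
  by rewrite -linear_formB //; apply: le_trans (cf.2 _) _; rewrite distrC.
have hy2 : `|h y - h (synthesis t N x)| <= eta / 2.
  by rewrite -linear_formB //; apply: le_trans (ch.2 _) _; rewrite distrC.
have split_x := synthesis_split t x (leq_addr N0 n : (n <= N)%N).
have main : `|f (synthesis t n x) - h (synthesis t n x)| <= 2 * d * M.
  rewrite /synthesis !linear_form_sum // -sumrB.
  apply: le_trans (ler_norm_sum _ _ _) _.
  apply: (@le_trans _ _ (\sum_(k < n) M * (2 * (d / n.+1%:R)))).
    apply: ler_sum => k _; rewrite -mulrBr normrM ler_pM //.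
      exact: schreier_bounded_coord.
    have [_ /(_ k (ltn_ord k)) + _] := Pf; have := hq k (ltn_ord k).
    rewrite [`|h _ - _|]distrC /= => h1 h2.
    apply: le_trans (ler_distD (ratr (nth 0 (mkseq q n) k)) _ _) _.
    by apply: le_trans (lerD h2 h1) _; rewrite mulr_natl mulr2n.
  rewrite sumr_const card_ord -[_ *+ n]mulr_natl.
  have -> : n%:R * (M * (2 * (d / n.+1%:R))) = 2 * d * M * (n%:R / n.+1%:R).
    by set b := n.+1%:R^-1; ring.
  have n1 : n%:R / n.+1%:R <= 1 :> R by rewrite ler_pdivrMr ?ltr0n // mul1r ler_nat.
  by rewrite ler_piMr // mulr_ge0 // mulr_ge0 // (ltW d0).
have tM := tail_bounded n xM; have tN := tail_below n xN.
have ta := @tail_above _ n x.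
have tail1 := fn _ _ _ tM ta tN; have tail2 := hn _ _ _ tM ta tN.
rewrite split_x (linear_formD _ _ lf) in hy1.
rewrite split_x (linear_formD _ _ lh) in hy2.
have total : 4 * d * M <= e * `|y|.
  have -> : 4 * d * M = 4 * K * d * `|y| by rewrite /M; ring.
  by rewrite ler_wpM2r.
apply: le_trans (dist_split hy1 hy2 main tail1 tail2) _.
by rewrite -splitr -!addrA addrC lerD2r; apply: le_trans total; lra.
Qed.

End Shrinking.

(** * Finite codimensional subspaces and coordinatewise compactness *)

Section CommonKernel.
Context {R : realType} {Y : normedModType R}.
Implicit Types (Z : set Y) (f : Y -> R) (phi : nat -> Y -> R).

Definition common_kernel phi Z m : set Y :=
  [set y | Z y /\ forall i, (i < m)%N -> phi i y = 0].

Lemma common_kernelS phi Z m :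
  common_kernel phi Z m.+1 = [set y | common_kernel phi Z m y /\ phi m y = 0].
Proof.
apply/seteqP; split=> y /=.
  by move=> [Zy y0]; split; [split=> // i im|]; apply: y0 => //; exact: ltnW.
move=> [[Zy y0] ym]; split=> // i; rewrite ltnS leq_eqVlt.
by move=> /predU1P[->|/y0].
Qed.

Lemma common_kernel_le phi Z m n y :
  (m <= n)%N -> common_kernel phi Z n y -> common_kernel phi Z m y.
Proof. by move=> mn [Zy y0]; split=> // i im; apply: y0; exact: leq_trans mn. Qed.

Lemma linear_subspaceZ Z a y : linear_subspace Z -> Z y -> Z (a *: y).
Proof. by move=> [Z0 ZD] Zy; have := ZD a y 0 Zy Z0; rewrite addr0. Qed.

Lemma linear_subspace_kernel Z f : linear_form f -> linear_subspace Z ->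
  linear_subspace [set y | Z y /\ f y = 0].
Proof.
move=> lf [Z0 ZD]; split; first by split; rewrite ?linear_form0.
move=> a x y /= [Zx fx] [Zy fy]; split; first exact: ZD.
by rewrite lf fx fy mulr0 addr0.
Qed.

(** If [f v] is nonzero, subtracting a multiple of [v] sends [Z] into the kernel; a finite list
    spanning the kernel, enlarged by [v], would span [Z]. *)
Lemma infinite_dimensional_kernel Z f : linear_form f -> linear_subspace Z ->
  infinite_dimensional Z -> infinite_dimensional [set y | Z y /\ f y = 0].
Proof.
move=> lf lZ iZ s; apply: contrapT => fin.
have fin_s y : Z y -> f y = 0 -> in_span s y.
  by move=> Zy fy; apply: contrapT => ny; apply: fin; exists y.
have [[v [Zv fv]]|no] := pselect (exists v, Z v /\ f v != 0); last first.
  have [z [Zz nz]] := iZ s; apply: nz; apply: fin_s => //.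
  by apply/eqP; apply: contrapT => fz; apply: no; exists z; split=> //; apply/negP.
have [z [Zz nz]] := iZ (v :: s); apply: nz.
have [||c [sc zc]] := @fin_s (- (f z / f v) *: v + z).
- exact: (lZ.2).
- by rewrite lf mulNr divfK // addNr.
exists ((f z / f v) :: c); split; first by rewrite /= sc.
by rewrite /= big_ord_recl /= -zc addrA scaleNr subrr add0r.
Qed.

Lemma common_kernel_subspace phi Z m : (forall i, linear_form (phi i)) ->
  linear_subspace Z -> linear_subspace (common_kernel phi Z m).
Proof.
move=> lphi lZ; elim: m => [|m IH].
  have -> // : common_kernel phi Z 0 = Z.
  by apply/seteqP; split=> y => [[]|] //; split.
by rewrite common_kernelS; exact: linear_subspace_kernel.
Qed.

Lemma common_kernel_unit phi Z m : (forall i, linear_form (phi i)) ->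
  linear_subspace Z -> infinite_dimensional Z ->
  exists z, common_kernel phi Z m z /\ `|z| = 1.
Proof.
move=> lphi lZ iZ.
have : infinite_dimensional (common_kernel phi Z m).
  elim: m => [|m IH].
    have -> // : common_kernel phi Z 0 = Z.
    by apply/seteqP; split=> y => [[]|] //; split.
  rewrite common_kernelS; apply: infinite_dimensional_kernel => //.
  exact: common_kernel_subspace.
move=> /(_ [::])[z [Wz nz]].
have z0 : z != 0.
  apply/eqP => z0; apply: nz; exists [::]; split=> //.
  by rewrite /= big_ord0.
exists (`|z|^-1 *: z); split.
  by apply: linear_subspaceZ => //; exact: common_kernel_subspace.
by rewrite normrZ normfV normr_id mulVf // normr_eq0.
Qed.

(** Some [phi m] approximates [f] uniformly on the bounded sequence, and it vanishes at [w i] as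
    soon as [m < i]. *)
Lemma common_kernel_weakly_null phi Z (w : nat -> Y) (B : R) :
  (forall f, contraction_form f -> forall e : R, 0 < e ->
     exists m, forall y, `|f y - phi m y| <= e * `|y|) ->
  (forall i, common_kernel phi Z i (w i)) -> (forall i, `|w i| <= B) ->
  weakly_null w.
Proof.
move=> dphi Ww wB f cf e e0.
have B0 : 0 < `|B| + 1 by rewrite ltr_wpDl.
have [m mP] := dphi f cf (e / (`|B| + 1)) (divr_gt0 e0 B0).
exists m.+1 => i mi; have := mP (w i); have [_ -> //] := Ww i.
rewrite subr0 => /le_trans; apply; rewrite mulrAC ler_pdivrMr // ler_pM2l //.
by have := wB i; have := ler_norm B; lra.
Qed.

(** By Tychonoff's theorem [X] has a cluster point in a product of segments; closeness at
    arbitrarily large [m] replaces a convergent subsequence. *)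
Lemma pointwise_cluster (X : nat -> nat -> R) (B : R) :
  (forall m k, `|X m k| <= B) ->
  exists x : nat -> R, forall N (e : R) m0, 0 < e ->
    exists m, (m0 <= m)%N /\ forall k, (k < N)%N -> `|X m k - x k| <= e.
Proof.
move=> XB.
have cpt : compact [set f : prod_topology (fun _ : nat => R) |
    forall i, `[- B, B]%classic (f i)].
  apply: (@tychonoff nat (fun _ => R : topologicalType) (fun _ => `[- B, B]%classic)).
  by move=> i; exact: segment_compact.
pose G : set_system (prod_topology (fun _ : nat => R)) := X @ \oo.
have [|x [_ xG]] := cpt G _.
  by exists 0%N => // m _ /= i; rewrite in_itv /= -ler_norml.
exists x => N e m0 e0.
have GA : G [set X m | m in [set m | (m0 <= m)%N]].
  by exists m0 => // m /= mm0; exists m.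
have xB : nbhs x [set f | forall k, (k < N)%N -> `|f k - x k| <= e].
  elim: N => [|N IH]; first by apply: filterS filterT => f.
  have : nbhs x [set f | `|f N - x N| <= e].
    have /(_ x)/= pc := @proj_continuous _ (fun _ : nat => R) N.
    have := pc [set r | `|r - x N| <= e]; apply; apply/nbhs_ballP.
    by exists e => //= r; rewrite -ball_normE /ball_ /= distrC => /ltW.
  move=> /(filterI IH); apply: filterS => f [f1 f2] k; rewrite ltnS leq_eqVlt.
  by move=> /predU1P[->|/f1].
have [f [[m mm0 <-] fx]] := xG _ _ GA xB.
by exists m.
Qed.

End CommonKernel.

(** * The two properties that can be secured by going deep into the kernels *)

Section Steps.
Context {R : realType} {Y : normedModType R}.
Implicit Types (z : nat -> Y) (a x : nat -> R).

Lemma synthesis_close z n (e : R) : 0 < e -> exists2 d : R, 0 < d &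
  forall a b, (forall k, (k < n)%N -> `|a k - b k| <= d) ->
    `|synthesis z n a - synthesis z n b| <= e.
Proof.
move=> e0; pose S := \sum_(k < n) `|z k|.
have S0 : 0 <= S by apply: sumr_ge0.
exists (e / (S + 1)); first by rewrite divr_gt0 // ltr_wpDl.
move=> a b ab; rewrite -synthesisB.
apply: le_trans (ler_norm_sum _ _ _) _.
apply: (@le_trans _ _ (\sum_(k < n) e / (S + 1) * `|z k|)).
  by apply: ler_sum => k _; rewrite normrZ ler_wpM2r // ab.
rewrite -mulr_sumr -/S mulrAC ler_pdivrMr ?ltr_wpDl // ler_pM2l //.
by rewrite lerDl.
Qed.

Lemma norm_convex_sum (s : seq (R * nat)) (v : nat -> Y) (e : R) :
  (forall c, c \in s -> 0 <= c.1) -> \sum_(c <- s) c.1 = 1 ->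
  (forall i, `|v i| <= e) -> `|\sum_(c <- s) c.1 *: v c.2| <= e.
Proof.
move=> s0 s1 ve; apply: le_trans (ler_norm_sum _ _ _) _.
rewrite -[leRHS]mul1r -s1 mulr_suml big_seq [leRHS]big_seq.
by apply: ler_sum => c /s0 c0; rewrite normrZ ger0_norm // ler_wpM2l.
Qed.

Lemma convex_sum_subr (s : seq (R * nat)) (v : nat -> Y) u :
  \sum_(c <- s) c.1 = 1 ->
  \sum_(c <- s) c.1 *: (v c.2 - u) = \sum_(c <- s) c.1 *: v c.2 - u.
Proof.
move=> s1; under eq_bigr do rewrite scalerBr.
by rewrite sumrB -scaler_suml s1 scale1r.
Qed.

Lemma dist_chain (s1 s2 s3 u v w : Y) (e : R) :
  `|s2 - s1| <= e -> `|v - u| <= e -> `|s3 - (v + w)| <= e ->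
  `|s1 - u - (w - (s3 - s2))| <= e + e + e.
Proof.
rewrite distrC => h1 h2 h3.
have -> : s1 - u - (w - (s3 - s2)) = (s1 - s2) + (v - u) + (s3 - (v + w)).
  rewrite !opprB opprD !addrA [RHS](ACl (1*4*7*5*2*(3*6))) /= subrr addr0.
  by rewrite [LHS](ACl (1*2*5*3*4)).
apply: le_trans (ler_normD _ _) (lerD _ h3).
exact: le_trans (ler_normD _ _) (lerD h1 h2).
Qed.

(** Quantitative linear independence of the first [n] vectors; it makes their coefficients range
    over a compact set. *)
Definition coef_bounded z n : Prop :=
  exists A : R, forall a i, (i < n)%N -> `|a i| <= A * `|synthesis z n a|.

Context (phi : nat -> Y -> R) (Z : set Y).
Context (cphi : forall m, contraction_form (phi m)) (lZ : linear_subspace Z).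
Context (dphi : forall f, contraction_form f -> forall e : R, 0 < e ->
  exists m, forall y, `|f y - phi m y| <= e * `|y|).

Local Notation W := (common_kernel phi Z).

Lemma kernel_subspace m : linear_subspace (W m).
Proof. by apply: common_kernel_subspace => // i; have [] := cphi i. Qed.

(** Otherwise there are unit vectors in the span and [w i] in deeper and deeper kernels whose sums
    have norm at most [1 / 2]. The unit vectors cluster at some [u], and the [w i] are weakly null,
    so averaging them by Mazur's theorem makes [u] too short. *)
Lemma mazur_step z n : coef_bounded z n -> exists m, forall a w, W m w ->
  `|synthesis z n a| <= 2 * `|synthesis z n a + w|.
Proof.
move=> [A zA]; apply: contrapT => no.
have /choice[F FP] : forall m, exists aw : (nat -> R) * Y, [/\ W m aw.2,
    `|synthesis z n aw.1| = 1, `|synthesis z n aw.1 + aw.2| <= 1 / 2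
  & forall k, `|aw.1 k| <= `|A|].
  move=> m; apply: contrapT => nm; apply: no; exists m => a w Ww.
  rewrite leNgt; apply/negP => lt; apply: nm.
  set u := synthesis z n a in lt.
  have u0 : 0 < `|u| by apply: le_lt_trans lt; rewrite mulr_ge0.
  (* Truncation makes the coefficient bound valid at every index; the summand [0] gives the shape of
     [synthesis_lin]. *)
  pose b k := `|u|^-1 * truncate n a k + 0.
  have bu : synthesis z n b = `|u|^-1 *: u.
    by rewrite /b synthesis_lin synthesis0 addr0 synthesis_truncate.
  have nb : `|synthesis z n b| = 1.
    by rewrite bu normrZ normfV normr_id mulVf // gt_eqF.
  exists (b, `|u|^-1 *: w); split=> //=.
  - by apply: linear_subspaceZ => //; exact: kernel_subspace.
  - rewrite bu -scalerDr normrZ normfV normr_id ler_pdivrMl //.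
    by move: lt; rewrite -/u; lra.
  - move=> k; have [kn|kn] := ltnP k n.
      apply: le_trans (zA b k kn) _; rewrite nb mulr1; exact: ler_norm.
    by rewrite /b truncate_supported // mulr0 addr0 normr0.
have [a aP] := @pointwise_cluster R (fun m => (F m).1) `|A|
  (fun m => let: And4 _ _ _ h := FP m in h).
(* This slack yields [|u + w i| <= 5 / 8] and [|u| >= 7 / 8], while averaging the [w i] down to norm
   [1 / 8] yields [|u| <= 3 / 4]. *)
have e0 : 0 < 1 / 8 :> R by lra.
have [d d0 dP] := synthesis_close z n e0.
have /choice[I IP] := fun i => aP n d i d0.
set u := synthesis z n a in dP *.
have close i : `|synthesis z n (F (I i)).1 - u| <= 1 / 8.
  by apply: dP => k kn; have [_] := IP i; apply.
pose w i := (F (I i)).2.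
have uw i : `|u + w i| <= 5 / 8.
  have [_ _ h _] := FP (I i); have := close i; rewrite distrC => h'.
  rewrite -[u](subrK (synthesis z n (F (I i)).1)) -addrA.
  by apply: le_trans (ler_normD _ _) _; apply: le_trans (lerD h' h) _; lra.
have wB i : `|w i| <= 5 / 8 + `|u|.
  rewrite -[w i](addKr u) addrC; apply: le_trans (ler_normB _ _) _.
  by rewrite lerD2r.
have ww : weakly_null w.
  apply: (common_kernel_weakly_null dphi _ wB) => i.
  by have [h _] := IP i; have [h' _ _ _] := FP (I i); exact: common_kernel_le h h'.
have [s [s0 s1 sw]] := weakly_null_convex ww e0.
have uws : `|\sum_(c <- s) c.1 *: (w c.2 - - u)| <= 5 / 8.
  apply: (norm_convex_sum (v := fun i => w i - - u)) => // i.
  by rewrite opprK addrC.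
rewrite convex_sum_subr // opprK in uws.
have u1 : 7 / 8 <= `|u|.
  have [_ h _ _] := FP (I 0%N); have := close 0%N.
  have := lerB_dist (synthesis z n (F (I 0%N)).1) u; rewrite h.
  by lra.
set S := \sum_(c <- s) c.1 *: w c.2 in sw uws.
have : `|u| <= 5 / 8 + 1 / 8.
  rewrite -[u](addKr S) addrC; apply: le_trans (ler_normB _ _) _.
  exact: lerD.
by lra.
Qed.

Context (t : nat -> Y) (C K : R) (K_gt0 : 0 < K).
Context (synC : forall n x M, schreier_bounded M x -> `|synthesis t n x| <= C * M).

(** Intermediate values are allowed because Mazur's theorem produces convex combinations of initial
    projections. *)
Definition cut p m (D : nat -> R) : Prop := [/\ forall k, 0 <= D k <= 1,
  forall k, (k < p)%N -> D k = 1 & forall k, (m <= k)%N -> D k = 0].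

(* Given liftings [x m] of [u m + w m] with [w m] deeper and deeper in the
   kernels, a coordinatewise cluster point [x] satisfies [T (P_j x) -> u] weakly,
   so by Mazur's theorem some convex combination [D] of the projections [P_j]
   gives [T (D x)] close to [u]. *)
Lemma cut_step z n p (e : R) : coef_bounded z n -> 0 < e -> exists m,
  forall a w N x, W m w -> `|synthesis z n a + w| <= 1 ->
    schreier_bounded K x -> supported_below N x ->
    `|synthesis t N x - (synthesis z n a + w)| <= m.+1%:R^-1 ->
    exists2 D, cut p m D &
      `|synthesis t N (fun k => D k * x k) - synthesis z n a| <= e.
Proof.
move=> zc e0; have [m0 m0P] := mazur_step zc; have [A zA] := zc.
apply: contrapT => no.
pose bad m (q : (nat -> R) * Y * nat * (nat -> R)) :=
  let: (a, w, N, x) := q in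
  [/\ W m w, `|synthesis z n a + w| <= 1, schreier_bounded K x,
      supported_below N x &
      `|synthesis t N x - (synthesis z n a + w)| <= m.+1%:R^-1 /\
      ~ exists2 D, cut p m D &
      `|synthesis t N (fun k => D k * x k) - synthesis z n a| <= e].
have /choice[F FP] : forall m, exists q, bad m q.
  move=> m; apply: contrapT => nm; apply: no; exists m => a w N x h1 h2 h3 h4 h5.
  by apply: contrapT => h6; apply: nm; exists (a, w, N, x).
(* The offset [m0] makes the estimate of [mazur_step] available for every counterexample, whence the
   bound [2] in [Fu]. *)
pose Fa m := (F (m0 + m)%N).1.1.1; pose Fw m := (F (m0 + m)%N).1.1.2.
pose FN m := (F (m0 + m)%N).1.2; pose Fx m := (F (m0 + m)%N).2.
have {}FP m : bad (m0 + m)%N (Fa m, Fw m, FN m, Fx m).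
  have := FP (m0 + m)%N; rewrite /Fa /Fw /FN /Fx.
  by case: (F (m0 + m)%N) => [[[a w] N] x].
have Fu m : `|synthesis z n (Fa m)| <= 2.
  have [h1 h2 _ _ _] := FP m.
  apply: le_trans (m0P _ _ (common_kernel_le (leq_addr m m0) h1)) _.
  by rewrite -[leRHS]mulr1 ler_pM2l.
(* Coefficients and lifting are packed into one sequence so that a single cluster point serves
   both. *)
pose X m k := if (k < n)%N then Fa m k else Fx m (k - n)%N.
have [|X0 X0P] := @pointwise_cluster R X (`|A| * 2 + K).
  move=> m k; rewrite /X; case: ifP => kn.
    apply: (@le_trans _ _ (`|A| * 2)); last by rewrite lerDl ltW.
    apply: le_trans (zA _ _ kn) _; apply: le_trans (ler_wpM2r (normr_ge0 _) (ler_norm A)) _.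
    exact: ler_wpM2l.
  have [_ _ h _ _] := FP m; apply: le_trans (schreier_bounded_coord _ h) _.
  by rewrite lerDr mulr_ge0.
pose a := X0; pose x k := X0 (n + k)%N.
pose u := synthesis z n a.
have e8 : 0 < e / 8 by rewrite divr_gt0.
(* The multiplier [D] is arbitrary: the gliding hump uses the constant [1], the conclusion the final
   cut. *)
have close j i : exists m, [/\ (i <= m)%N,
    `|synthesis z n (Fa m) - u| <= e / 8 &
    forall D, (forall k, 0 <= D k <= 1) ->
      `|synthesis t j (fun k => D k * Fx m k) -
        synthesis t j (fun k => D k * x k)| <= e / 8].
  have [d d0 dP] := synthesis_close z n e8.
  have [d' d'0 d'P] := synthesis_close t j e8.
  have dd' : 0 < Num.min d d' by rewrite lt_min d0.
  have [m [im mP]] := X0P (n + j)%N _ i dd'.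
  exists m; split=> // [|D D01].
    apply: dP => k kn; have := mP k (leq_trans kn (leq_addr _ _)).
    by rewrite /X kn le_min => /andP[].
  apply: d'P => k kj; rewrite -mulrBr normrM.
  have /andP[D0 D1] := D01 k; rewrite (ger0_norm D0).
  apply: le_trans (ler_piMl (normr_ge0 _) D1) _.
  have := mP (n + k)%N; rewrite ltn_add2l => /(_ kj).
  rewrite /X ltnNge leq_addr /= addKn le_min => /andP[] //.
have [i0 i0P] := nat_bound (8 / e).
have step (i j : nat) : exists j' m, [/\ (i + i0 <= m)%N, (j < j')%N,
    supported_below j' (Fx m),
    `|synthesis z n (Fa m) - u| <= e / 8 &
    `|synthesis t j (Fx m) - synthesis t j x| <= e / 8].
  have [m [im m1 m2]] := close j (i + i0)%N.
  exists (maxn j.+1 (FN m)), m; split=> //; first exact: leq_maxl.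
    move=> k; rewrite geq_max => /andP[_ kN].
    by have [_ _ _ h _] := FP m; exact: h.
  have := m2 (fun=> 1); rewrite /synthesis.
  under eq_bigr do rewrite mul1r.
  under [X in `|_ - X|]eq_bigr do rewrite mul1r.
  by apply=> k; rewrite ler01 lexx.
have [j [I [j0 IP]]] := sequential_choice step p.
have j_mono i : (j i <= j i.+1)%N by apply: ltnW; have [] := IP i.
have j_ge i : (i <= j i)%N.
  by elim: i => // i IH; apply: leq_ltn_trans IH _; have [] := IP i.
have mono : {homo j : k l / (k <= l)%N} := homo_leq (@leqnn) leq_trans j_mono.
(* The lifting splits at [j i] into a part close to [x] and the remainder [b i]. So
   [T (P_(j i) x) - u] is close to [v i], which is weakly null: [Fw (I i)] lies deep in the kernels
   and [b i] lives far out. *)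
pose b i := tail (j i) (Fx (I i)).
pose v i := Fw (I i) - synthesis t (j i.+1) (b i).
have vE i : `|synthesis t (j i) x - u - v i| <= 3 * e / 8.
  have [h1 /ltnW h2 h3 h4 h5] := IP i; have [_ _ _ g4 [g5 _]] := FP (I i).
  set xi := Fx (I i) in h3 h5 g4 g5; set ui := synthesis z n (Fa (I i)) in h4 g5.
  have synN : synthesis t (FN (I i)) xi = synthesis t (j i.+1) xi.
    rewrite -(synthesis_widen t (leq_maxl (FN (I i)) (j i.+1)) g4).
    by rewrite (synthesis_widen t (leq_maxr (FN (I i)) (j i.+1)) h3).
  have synb : synthesis t (j i.+1) (b i) =
      synthesis t (j i.+1) xi - synthesis t (j i) xi.
    rewrite /b /tail synthesisB; congr (_ - _).
    by rewrite (synthesis_widen t h2 (@truncate_supported _ _ _)) synthesis_truncate.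
  rewrite synN in g5.
  have small : `|synthesis t (j i.+1) xi - (ui + Fw (I i))| <= e / 8.
    apply: le_trans g5 _.
    have -> : e / 8 = (8 / e)^-1 by rewrite invf_div.
    rewrite lef_pV2 ?posrE ?ltr0n ?divr_gt0 //; apply: le_trans i0P _.
    by rewrite ler_nat; lia.
  rewrite /v synb.
  set s1 := synthesis t (j i) x in h5 *; set s2 := synthesis t (j i) xi in h5 *.
  set s3 := synthesis t (j i.+1) xi in small *; set wi := Fw _ in small *.
  apply: le_trans (dist_chain h5 h4 small) _.
  by rewrite le_eqVlt; apply/orP; left; apply/eqP; field.
have wv : weakly_null v.
  move=> f cf eps eps0.
  have eps2 : 0 < eps / 2 by rewrite divr_gt0.
  have [n1 n1P] := shrinking synC cf (divr_gt0 eps2 K_gt0).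
  have [|i|n2 n2P] := @common_kernel_weakly_null _ _ phi Z (fun i => Fw (I i)) 3
      dphi _ _ f cf _ eps2.
  - move=> i; have [h _ _ _ _] := FP (I i); have [g _ _ _ _] := IP i.
    by apply: common_kernel_le h; lia.
  - have [_ h _ _ _] := FP (I i).
    rewrite -[Fw _](addKr (synthesis z n (Fa (I i)))) addrC.
    by apply: le_trans (ler_normB _ _) _; apply: le_trans (lerD h (Fu _)) _; lra.
  exists (maxn n1 n2) => i; rewrite geq_max => /andP[i1 i2].
  rewrite /v linear_formB; last exact: cf.1.
  have [_ _ h3 _ _] := IP i; have [_ _ g3 _ _] := FP (I i).
  have := n1P _ _ _ (tail_bounded (j i) g3) _ (tail_below (j i) h3).
  rewrite divfK ?gt_eqF // => small.
  apply: le_trans (ler_normB _ _) _; rewrite [leRHS]splitr.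
  apply: lerD; first exact: n2P.
  apply: small => k kn; apply: tail_above; apply: leq_trans kn _.
  exact: leq_trans i1 (j_ge i).
have [s [s0 s1 sv]] := weakly_null_convex wv e8.
pose S := \sum_(c <- s) c.1 *: synthesis t (j c.2) x.
have Su : `|S - u| <= e / 2.
  have := norm_convex_sum s0 s1 vE.
  under eq_bigr do rewrite scalerBr.
  rewrite sumrB (convex_sum_subr (fun i => synthesis t (j i) x) u s1) -/S => h.
  rewrite -[S - u](subrK (\sum_(c <- s) c.1 *: v c.2)).
  apply: le_trans (ler_normD _ _) _; apply: le_trans (lerD h sv) _.
  by rewrite le_eqVlt; apply/orP; left; apply/eqP; field.
pose J := \max_(c <- s) j c.2.
have jJ c : c \in s -> (j c.2 <= J)%N.
  by move=> cs; exact: (@leq_bigmax_seq _ s predT (fun c => j c.2)).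
(* The convex combination of the projections [P_(j i)], written as a multiplier. *)
pose D k := \sum_(c <- s) (if (k < j c.2)%N then c.1 else 0).
have D01 k : 0 <= D k <= 1.
  apply/andP; split; rewrite /D big_seq.
    by apply: sumr_ge0 => c /s0 c0; case: ifP.
  by rewrite -s1 [leRHS]big_seq; apply: ler_sum => c /s0 c0; case: ifP.
have D1 k : (k < p)%N -> D k = 1.
  move=> kp; rewrite -s1; apply: eq_bigr => c _.
  by rewrite (leq_trans kp) // -j0; exact: mono.
have D0 k : (J <= k)%N -> D k = 0.
  move=> Jk; rewrite /D big_seq big1 // => c /jJ jc.
  by rewrite ltnNge (leq_trans jc Jk).
have synD : synthesis t J (fun k => D k * x k) = S.
  rewrite /S [RHS]big_seq.
  transitivity (\sum_(c <- s | c \in s) c.1 *: synthesis t J (truncate (j c.2) x)).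
    rewrite -big_seq /synthesis /D /=.
    under eq_bigr do rewrite mulr_suml scaler_suml.
    rewrite exchange_big; apply: eq_bigr => c _; rewrite scaler_sumr.
    apply: eq_bigr => k _; rewrite scalerA /truncate.
    by case: ifP; rewrite ?mul0r ?mulr0.
  apply: eq_bigr => c /jJ jc.
  by rewrite (synthesis_widen t jc (@truncate_supported _ _ _)) synthesis_truncate.
have [m [Jm m1 m2]] := close J J.
have [_ _ _ xN [_ h]] := FP m; apply: h; exists D.
  by split=> // k km; apply: D0; move: km; lia.
have -> : synthesis t (FN m) (fun k => D k * Fx m k) =
          synthesis t J (fun k => D k * Fx m k).
  rewrite -(synthesis_widen t (leq_addr J (FN m))); last first.
    by move=> k kN; rewrite xN // mulr0.
  by rewrite (synthesis_widen t (leq_addl (FN m) J)) // => k kJ; rewrite D0 // mul0r.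
have := m2 D D01; rewrite synD => h1.
rewrite distrC in m1.
apply: le_trans (ler_distD S _ _) _; apply: le_trans (lerD h1 (ler_distD u _ _)) _.
apply: le_trans (lerD (lexx _) (lerD Su m1)) _.
by lra.
Qed.

End Steps.

(** * A criterion for spanning a copy of [c_0] *)

Section FromSequence.
Context {R : realType} {Y : completeNormedModType R}.
Implicit Types (u : nat -> R) (v : nat -> Y).

Lemma synthesis_mem (S : set Y) v N u : linear_subspace S ->
  (forall i, (i < N)%N -> u i = 0 \/ S (v i)) -> S (synthesis v N u).
Proof.
move=> lS; elim: N => [|N IH] h; first by rewrite /synthesis big_ord0; exact: lS.1.
rewrite /synthesis big_ord_recr /= addrC.
have Sn : S (synthesis v N u) by apply: IH => i iN; apply: h; exact: ltnW.
have [->|SN] := h N (leqnn _); last exact: lS.2.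
by rewrite scale0r add0r.
Qed.

Lemma c0_bounded u : c0_space u -> has_ubound (range (fun n => `|u n|)).
Proof.
move=> /cvgr0Pnorm_le/(_ 1 ltr01)[N _ uN].
exists (1 + \sum_(k < N) `|u k|) => _ [n _ <-].
have [nN|Nn] := ltnP n N; last first.
  by apply: le_trans (uN n Nn) _; rewrite lerDl sumr_ge0.
by rewrite (bigD1 (Ordinal nN)) //= addrCA lerDl addr_ge0 // sumr_ge0.
Qed.

Lemma le_sup_norm u n : c0_space u -> `|u n| <= sup_norm u.
Proof. by move=> /c0_bounded cu; apply: ub_le_sup => //; exists n. Qed.

(** The embedding sends [u] to the sum of the series of [u j *: v j], which is Cauchy by the upper
    estimate applied to tails of [u]. Below, a term is the difference of two partial sums, so
    [|u k| / 2 <= 4 * |J u|], whence the constant [1 / 8]. *)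
Lemma contains_c0_of_sequence (Z : set Y) v (M : R) :
  linear_subspace Z -> closed Z -> (forall j, Z (v j)) ->
  (forall n N b, (n <= N)%N -> `|synthesis v n b| <= 2 * `|synthesis v N b|) ->
  (forall j, 1 / 2 <= `|v j|) ->
  (forall N b (B : R), 0 <= B -> (forall j, (j < N)%N -> `|b j| <= B) ->
     `|synthesis v N b| <= M * B) ->
  contains_c0 Z.
Proof.
move=> lZ cZ Zv v_proj v_ge v_le.
have cvg_syn u : c0_space u -> cvg (synthesis v n u @[n --> \oo]).
  move=> cu; apply: cauchy_cvg; apply: cauchy_exP => e e0.
  have d0 : 0 < e / (2 * (`|M| + 1)) by rewrite divr_gt0 // mulr_gt0 // ltr_wpDl.
  have [n _ un] := (cvgr0Pnorm_le _).1 cu _ d0.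
  exists (synthesis v n u); exists n => // N /= nN.
  rewrite -ball_normE /ball_ /= (synthesis_split v u nN) opprD addNKr normrN.
  apply: (@le_lt_trans _ _ (M * (e / (2 * (`|M| + 1))))).
    apply: v_le => [|j _]; first exact: ltW.
    rewrite /tail /truncate; case: ltnP => [_|nj]; last by rewrite subr0 un.
    by rewrite subrr normr0 ltW.
  apply: le_lt_trans (ler_norm _) _; rewrite normrM (gtr0_norm d0) mulrA ltr_pdivrMr.
    by rewrite mulrC ltr_pM2l //; have := normr_ge0 M; lra.
  by rewrite mulr_gt0 // ltr_wpDl.
pose J u : Y := lim (synthesis v n u @[n --> \oo]).
have JP u : c0_space u -> synthesis v n u @[n --> \oo] --> J u by move/cvg_syn.
have near_J u (e : R) k : c0_space u -> 0 < e ->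
    exists2 n, (k <= n)%N & `|J u - synthesis v n u| <= e.
  move=> /JP/cvgrPdist_le/(_ e) + e0 => /(_ e0)[N _ hN].
  by exists (maxn k N); [exact: leq_maxl|apply: hN; exact: leq_maxr].
exists J; split.
- move=> a u w cu cw; apply: cvg_lim => //.
  under eq_cvg do rewrite synthesis_lin.
  by apply: cvgD (JP _ cw); apply: cvgZr (JP _ cu).
- move=> u cu; apply: (closed_cvg Z cZ _ _ (JP u cu)).
  by apply: nearW => n; apply: synthesis_mem => // i _; right.
- exists (1 / 8), M; split; first lra.
  move=> u cu; split.
    suff h : sup_norm u <= 8 * `|J u| by lra.
    apply: ge_sup; first by exists `|u 0%N|, 0%N.
    move=> _ [k _ <-]; apply/ler_addgt0Pr => e e0.
    have [n kn hn] := near_J u (e / 8) k.+1 cu (divr_gt0 e0 (ltr0n _ 8)).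
    have h1 := v_proj _ _ u kn; have h2 := v_proj _ _ u (ltnW kn).
    have h3 : `|u k| * `|v k| <= `|synthesis v k.+1 u| + `|synthesis v k u|.
      rewrite -normrZ; have -> : u k *: v k = synthesis v k.+1 u - synthesis v k u.
        by rewrite synthesisS addrAC subrr add0r.
      exact: ler_normB.
    have h4 : `|u k| * (1 / 2) <= `|u k| * `|v k| by rewrite ler_wpM2l.
    have h5 : `|synthesis v n u| <= `|J u| + e / 8.
      rewrite -[synthesis v n u](subrK (J u)) addrC.
      by apply: le_trans (ler_normD _ _) _; rewrite lerD2l distrC.
    clear - h1 h2 h3 h4 h5.
    move: (`|u k|) (`|v k|) (`|J u|) (`|synthesis v k u|) (`|synthesis v k.+1 u|)
      (`|synthesis v n u|) h1 h2 h3 h4 h5 => *; lra.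
  apply/ler_addgt0Pr => e e0; have [n _ hn] := near_J u e 0%N cu e0.
  rewrite -[J u](subrK (synthesis v n u)) addrC.
  apply: le_trans (ler_normD _ _) _; apply: lerD hn; apply: v_le => [|j _].
    exact: le_trans (normr_ge0 _) (le_sup_norm 0%N cu).
  exact: le_sup_norm.
Qed.

End FromSequence.

(** * Construction of the basic sequence *)

Section Construction.
Context {R : realType} {Y : completeNormedModType R}.

Lemma history_choice (A : Type) (P : seq A -> A -> Prop) :
  (forall s, exists a, P s a) -> exists g : nat -> A, forall n, P (mkseq g n) (g n).
Proof.
move=> /choice[F FP]; pose st n := iter n (fun s => rcons s (F s)) [::].
exists (fun n => F (st n)) => n.
suff -> : mkseq (fun n => F (st n)) n = st n by exact: FP.
by elim: n => // n IH; rewrite mkseqS IH.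
Qed.

Context (phi : nat -> Y -> R) (Z : set Y).
Context (cphi : forall m, contraction_form (phi m)).
Context (dphi : forall f, contraction_form f -> forall e : R, 0 < e ->
  exists m, forall y, `|f y - phi m y| <= e * `|y|).
Context (lZ : linear_subspace Z) (iZ : infinite_dimensional Z).
Context (t : nat -> Y) (C K : R) (K_gt0 : 0 < K).
Context (synC : forall n x M, schreier_bounded M x -> `|synthesis t n x| <= C * M).

Local Notation W := (common_kernel phi Z).

Definition mazur_at (z : nat -> Y) n m : Prop := forall a w, W m w ->
  `|synthesis z n a| <= 2 * `|synthesis z n a + w|.

Definition cut_at (z : nat -> Y) n p m (e : R) : Prop := forall a w N x,
  W m w -> `|synthesis z n a + w| <= 1 ->
  schreier_bounded K x -> supported_below N x ->
  `|synthesis t N x - (synthesis z n a + w)| <= m.+1%:R^-1 ->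
  exists2 D, cut p m D &
    `|synthesis t N (fun k => D k * x k) - synthesis z n a| <= e.

Lemma mazur_atW z n m m' : (m <= m')%N -> mazur_at z n m -> mazur_at z n m'.
Proof. by move=> mm' h a w /(common_kernel_le mm'); exact: h. Qed.

Lemma cut_atW z n p m m' e : (m <= m')%N -> cut_at z n p m e -> cut_at z n p m' e.
Proof.
move=> mm' h a w N x /(common_kernel_le mm') Ww uw xK xN le_x.
have [|D [D01 D1 D0] hD] := h a w N x Ww uw xK xN.
- by apply: le_trans le_x _; rewrite lef_pV2 ?posrE ?ltr0n // ler_nat ltnS.
by exists D => //; split=> // k km; apply: D0; exact: leq_trans km.
Qed.

(** Dropping the last term at most doubles the norm: old coefficients cost [2 * |A|], and the new
    one, a difference of two partial sums, costs [1 + 2]. *)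
Lemma coef_boundedS z n m : coef_bounded z n -> mazur_at z n m -> W m (z n) ->
  `|z n| = 1 -> coef_bounded z n.+1.
Proof.
move=> [A zA] zm Wz z1; exists (`|A| * 2 + 3) => a i.
have Wn : W m (a n *: z n).
  by apply: linear_subspaceZ => //; exact: kernel_subspace.
have := zm a _ Wn.
rewrite -synthesisS.
move=> le2; rewrite ltnS leq_eqVlt => /predU1P[->|ilt].
  have -> : `|a n| = `|synthesis z n.+1 a - synthesis z n a|.
    by rewrite synthesisS addrAC subrr add0r normrZ z1 mulr1.
  apply: le_trans (ler_normB _ _) _; apply: le_trans (lerD (lexx _) le2) _.
  rewrite -{1}[`|synthesis z n.+1 a|]mul1r -mulrDl ler_wpM2r //.
  by have := normr_ge0 A; lra.
apply: le_trans (zA a i ilt) _.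
apply: le_trans (ler_wpM2r (normr_ge0 _) (ler_norm A)) _.
apply: le_trans (ler_wpM2l (normr_ge0 A) le2) _.
by rewrite mulrA ler_wpM2r // lerDl.
Qed.

Lemma basic_sequence : exists (z : nat -> Y) (m : nat -> nat), [/\
  forall n, (m n < m n.+1)%N,
  forall n, mazur_at z n (m n.+1),
  forall n, cut_at z n (m n) (m n.+1) ((1 / 2) ^+ n)
& forall n, W (m n.+1) (z n) /\ `|z n| = 1].
Proof.
(* A history lists the pairs [(z i, m i.+1)]; for the empty history the default value gives
   [m 0 = 0]. *)
pose zs (s : seq (Y * nat)) i := (nth (0, 0%N) s i).1.
pose ps (s : seq (Y * nat)) := (last (0, 0%N) s).2.
(* The hypothesis [coef_bounded] lets the choice be made for all histories; it is discharged
   afterwards by induction with [coef_boundedS]. *)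
pose P (s : seq (Y * nat)) (q : Y * nat) := coef_bounded (zs s) (size s) ->
  [/\ (ps s < q.2)%N, mazur_at (zs s) (size s) q.2,
      cut_at (zs s) (size s) (ps s) q.2 ((1 / 2) ^+ size s),
      W q.2 q.1 & `|q.1| = 1].
have [s|g gP] := @history_choice _ P.
  have [cb|no] := pselect (coef_bounded (zs s) (size s)); last by exists (0, 0%N).
  have e0 : 0 < (1 / 2) ^+ size s :> R by rewrite exprn_gt0.
  have [m1 m1P] := mazur_step cphi lZ dphi cb.
  have [m2 m2P] := cut_step cphi lZ dphi K_gt0 synC (ps s) cb e0.
  pose m := (m1 + m2 + (ps s).+1)%N.
  have [z [Wz z1]] := common_kernel_unit m (fun i => (cphi i).1) lZ iZ.
  exists (z, m) => _; split=> //=.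
  - by rewrite /m; lia.
  - by apply: (mazur_atW _ m1P); rewrite /m; lia.
  - by apply: (cut_atW _ m2P); rewrite /m; lia.
pose z n := (g n).1; pose m n := if n is n'.+1 then (g n').2 else 0%N.
have syn_g n : synthesis (zs (mkseq g n)) n = synthesis z n.
  apply/funext => a; apply: eq_bigr => k _.
  by rewrite /zs nth_mkseq ?ltn_ord.
have ps_g n : ps (mkseq g n) = m n.
  by rewrite /ps; case: n => // n; rewrite mkseqS last_rcons.
have main n : coef_bounded z n -> [/\ (m n < m n.+1)%N, mazur_at z n (m n.+1),
    cut_at z n (m n) (m n.+1) ((1 / 2) ^+ n), W (m n.+1) (z n) & `|z n| = 1].
  move=> cb; have := gP n.
  rewrite /P size_mkseq ps_g /coef_bounded /mazur_at /cut_at syn_g.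
  exact.
have cb n : coef_bounded z n.
  elim: n => [|n IH]; first by exists 0.
  by have [_ h2 _ h4 h5] := main n IH; exact: coef_boundedS h2 h4 h5.
by exists z, m; split=> // n; have [] := main n (cb n).
Qed.

End Construction.

(** * Flat blocks, and the two cases of the conclusion *)

Section Saturation.
Context {R : realType} {Y : completeNormedModType R}.

Lemma telescope_from (V : zmodType) (F : nat -> V) l n : (l <= n)%N ->
  \sum_(i < n) (if (l <= i)%N then F i.+1 - F i else 0) = F n - F l.
Proof.
elim: n => [|n IH]; first by rewrite leqn0 => /eqP ->; rewrite big_ord0 subrr.
rewrite big_ord_recr /= leq_eqVlt => /predU1P[->|].
  by rewrite ltnn addr0 subrr big1 // => i _; rewrite leqNgt ltnS (ltnW (ltn_ord i)).
by rewrite ltnS => ln; rewrite ln IH // addrC addrA subrK.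
Qed.

Lemma geometric_tail l n :
  \sum_(i < n) (if (l <= i)%N then (1 / 2) ^+ i else 0) <= 2 * (1 / 2) ^+ l :> R.
Proof.
have p0 i : 0 <= (1 / 2) ^+ i :> R by rewrite exprn_ge0.
have [ln|nl] := leqP l n; last first.
  rewrite big1 ?mulr_ge0 // => i _; case: leqP => // li.
  by have := ltn_ord i; move: nl li; lia.
have := telescope_from (fun i => - (2 * (1 / 2) ^+ i) : R) ln.
have -> : \sum_(i < n) (if (l <= i)%N then
    - (2 * (1 / 2) ^+ i.+1) - - (2 * (1 / 2) ^+ i) else 0) =
    \sum_(i < n) (if (l <= i)%N then (1 / 2) ^+ i else 0) :> R.
  by apply: eq_bigr => i _; case: ifP => // _; rewrite exprS; field.
by move=> ->; have := p0 n; lra.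
Qed.

(** Any [N] of these coordinates form a test set, on which the sum would be at least [N * eta],
    hence above [K]. *)
Lemma few_large_coords (K eta : R) (x : nat -> R) N n (r : seq nat) :
  schreier_bounded K x -> K < N%:R * eta -> (N <= n.+1)%N -> uniq r ->
  (forall k, k \in r -> (n <= k)%N /\ eta <= `|x k|) -> (size r < N)%N.
Proof.
move=> xK KN Nn ur rP; rewrite ltnNge; apply/negP => Nr.
have sN : size (take N r) = N by rewrite size_takel.
have sub k : k \in take N r -> k \in r by exact: mem_take.
have := xK n (take N r) (take_uniq _ ur).
rewrite sN => /(_ _ Nn) h.
have : \sum_(k <- take N r) `|x k| <= K by apply: h => k /sub/rP[].
apply/negP; rewrite -ltNge; apply: lt_le_trans KN _.
rewrite -{1}sN -sum1_size natr_sum mulr_suml big_seq [leRHS]big_seq.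
by apply: ler_sum => k /sub/rP[_]; rewrite mul1r.
Qed.

Lemma dist_diff (u v u' v' : Y) (d e : R) :
  `|u - u'| <= d -> `|v' - v| <= e -> `|u - v - (u' - v')| <= d + e.
Proof.
move=> ud ve; have -> : u - v - (u' - v') = (u - u') + (v' - v).
  by rewrite opprB [v' - u']addrC addrACA [- v + v']addrC.
exact: le_trans (ler_normD _ _) (lerD ud ve).
Qed.

Context (phi : nat -> Y -> R) (Z : set Y).
Context (cphi : forall m, contraction_form (phi m)).
Context (lZ : linear_subspace Z) (cZ : closed Z).
Context (t : nat -> Y) (C K : R) (K_gt0 : 0 < K).
Context (synC : forall n x M, schreier_bounded M x -> `|synthesis t n x| <= C * M).
Context (lift : forall (y : Y) (e : R), 0 < e -> exists n x, [/\ supported_below n x,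
  schreier_bounded (K * `|y|) x & `|synthesis t n x - y| <= e]).

Local Notation W := (common_kernel phi Z).

Context (z : nat -> Y) (m : nat -> nat).
Context (m_lt : forall n, (m n < m n.+1)%N).
Context (mazur : forall n, mazur_at phi Z z n (m n.+1)).
Context (cuts : forall n, cut_at phi Z t K z n (m n) (m n.+1) ((1 / 2) ^+ n)).
Context (zW : forall n, W (m n.+1) (z n) /\ `|z n| = 1).

Lemma m_mono : {homo m : i j / (i <= j)%N}.
Proof. by apply: homo_leq; [exact: leqnn|exact: leq_trans|move=> i; exact: ltnW]. Qed.

Lemma m_ge n : (n <= m n)%N.
Proof. by elim: n => // n IH; exact: leq_ltn_trans (m_lt n). Qed.

Lemma synthesis_deep n N (a : nat -> R) :
  supported_above n a -> W (m n.+1) (synthesis z N a).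
Proof.
move=> an; apply: synthesis_mem; first exact: kernel_subspace.
move=> i _; have [lt_in|ni] := ltnP i n; first by left; exact: an.
by right; apply: common_kernel_le (zW i).1; apply: m_mono.
Qed.

Lemma synthesis_unit_le n (a : nat -> R) (B : R) :
  (forall i, (i < n)%N -> `|a i| <= B) -> `|synthesis z n a| <= n%:R * B.
Proof.
move=> aB; apply: le_trans (ler_norm_sum _ _ _) _.
apply: (@le_trans _ _ (\sum_(i < n) B)); last by rewrite sumr_const card_ord mulr_natl.
by apply: ler_sum => i _; rewrite normrZ (zW i).2 mulr1 aB.
Qed.

Context (unbounded : forall M : R, exists n a,
  (forall i, (i < n)%N -> `|a i| <= 1) /\ M < `|synthesis z n a|).

(** A combination with coefficients at most [1] and norm above [l + gamma^-1] loses at most [l] with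
    its first [l] terms; normalizing the rest divides the coefficients by more than [gamma^-1]. *)
Lemma flat_unit_vector l (gamma : R) : 0 < gamma -> exists n a, [/\ (l <= n)%N,
  supported_above l a, supported_below n a,
  forall i, `|a i| <= gamma & `|synthesis z n a| = 1].
Proof.
move=> g0; have [n [a0 [a01 big]]] := unbounded (l%:R + gamma^-1).
have gV0 : 0 < gamma^-1 by rewrite invr_gt0.
have ln : (l <= n)%N.
  rewrite leqNgt; apply/negP => nl.
  have : n%:R <= l%:R :> R by rewrite ler_nat ltnW.
  have := synthesis_unit_le a01; rewrite mulr1.
  by move: gV0 big; move: (gamma^-1) (`|_|) => *; lra.
set nu := `|synthesis z n (tail l a0)|.
have nu_gt : gamma^-1 < nu.
  have h1 : `|synthesis z l a0| <= l%:R.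
    by rewrite -[leRHS]mulr1; apply: synthesis_unit_le => i il; apply/a01/(leq_trans il).
  move: big; rewrite (synthesis_split z a0 ln) => big.
  have := ler_normD (synthesis z l a0) (synthesis z n (tail l a0)).
  rewrite -/nu; move: big h1; move: (gamma^-1) nu (`|synthesis z l a0|) => *; lra.
have nu0 : 0 < nu by apply: lt_trans nu_gt.
pose a k := nu^-1 * truncate n (tail l a0) k + 0.
exists n, a; split=> //.
- by move=> k kl; rewrite /a /truncate tail_above // if_same mulr0 addr0.
- by move=> k kn; rewrite /a truncate_supported // mulr0 addr0.
- move=> i; rewrite /a addr0 normrM gtr0_norm ?invr_gt0 //.
  apply: (@le_trans _ _ (nu^-1 * 1)).
    rewrite ler_pM2l ?invr_gt0 // /truncate; case: ifP => [i_n|_]; last by rewrite normr0.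
    by rewrite /tail /truncate; case: ifP => _; rewrite ?subrr ?normr0 // subr0 a01.
  by rewrite mulr1 -[gamma]invrK lef_pV2 ?posrE // ltW.
- rewrite /a synthesis_lin synthesis0 addr0 synthesis_truncate.
  by rewrite normrZ gtr0_norm ?invr_gt0 // mulVf // gt_eqF.
Qed.

(* Cut a lifting [x] of a flat unit vector [\sum_i a i z i] into pieces
   [E i * x] with [T (E i * x)] close to [a i z i].  Only boundedly many
   coordinates of [x] exceed [eta], so deleting the indices [i] whose piece meets
   one of them costs little norm and leaves a lifting of sup norm at most [eta]. *)
Lemma flat_block L (eta theta : R) : 0 < eta -> 0 < theta ->
  exists n a g, [/\ (L <= n)%N /\ (supported_above L a /\ supported_below n a),
    supported_above (m L) g /\ supported_below (m n.+1) g,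
    schreier_bounded K g /\ (forall k, `|g k| <= eta),
    1 / 2 <= `|synthesis z n a| &
    `|synthesis z n a - synthesis t (m n.+1) g| <= theta].
Proof.
move=> eta0 theta0.
have [N0 KN0] := nat_bound (K / eta); pose N := N0.+1.
have KN : K < N%:R * eta.
  rewrite -ltr_pdivrMr //; by apply: le_lt_trans KN0 _; rewrite ltr_nat.
have N_gt0 : 0 < N%:R :> R by rewrite ltr0n.
have [l0 l0P] := nat_bound (4 / theta).
(* The three summands ensure the position past [L], the size condition of [few_large_coords], and
   [4 / 2 ^ l <= theta]. *)
pose l := (L + N + l0)%N.
have Ll : (L <= l)%N by rewrite /l; lia.
have Nl : (N <= l)%N by rewrite /l; lia.
have half_l : 4 * (1 / 2) ^+ l <= theta.
  rewrite div1r exprVn -natrX ler_pdivrMr ?ltr0n ?expn_gt0 //.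
  rewrite -ler_pdivrMl // mulrC; apply: le_trans l0P _; rewrite ler_nat.
  by apply: ltnW; apply: leq_ltn_trans (ltn_expl l (ltnSn 1)); rewrite /l; lia.
(* Fewer than [N] coordinates are large and each meets at most two pieces, so the deleted terms have
   total norm at most [2 * N * gamma = 1 / 2]. *)
pose gamma : R := 1 / (4 * N%:R).
have gamma0 : 0 < gamma by rewrite divr_gt0 // mulr_gt0.
have [n [a [ln a_above a_below a_small a1]]] := flat_unit_vector l gamma0.
have tol0 : 0 < (m n.+1).+1%:R^-1 :> R by rewrite invr_gt0 ltr0n.
have [NX [x [xN xK xy]]] := lift (synthesis z n a) tol0.
rewrite a1 mulr1 in xK.
have /choice[D DP] : forall i, exists D, (l <= i <= n)%N -> cut (m i) (m i.+1) D /\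
    `|synthesis t NX (fun k => D k * x k) - synthesis z i a| <= (1 / 2) ^+ i.
  move=> i; have [/andP[li i_n]|_] := boolP (l <= i <= n)%N; last by exists (fun=> 0).
  have Wi := synthesis_deep n (@tail_above _ i a).
  have [||D cD hD] := @cuts i a _ NX x Wi _ xK xN.
  - by rewrite -synthesis_split // a1.
  - rewrite -synthesis_split //; apply: le_trans xy _.
    by rewrite lef_pV2 ?posrE ?ltr0n // ler_nat ltnS; apply: m_mono.
  by exists D.
(* Differences of consecutive cuts. They are nonnegative because [D i.+1] is [1] wherever [D i] is
   nonzero, and they live on [[m i, m i.+2)], so only neighbouring pieces overlap. *)
pose E i k := if (l <= i)%N then D i.+1 k - D i k else 0.
have E01 i k : (i < n)%N -> 0 <= E i k <= 1 /\ (E i k != 0 -> (m i <= k < m i.+2)%N).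
  rewrite /E; case: ifP => [li i_n|_ _]; last by rewrite lexx ler01 eqxx.
  have [|[d01 d1 d0] _] := DP i; first by rewrite li ltnW.
  have [|[e01 e1 e0] _] := DP i.+1; first by rewrite i_n ltnW.
  have /andP[dk0 dk1] := d01 k; have /andP[ek0 ek1] := e01 k; split.
    have [ki|ki] := ltnP k (m i.+1); last by rewrite (d0 _ ki) subr0 ek0.
    by rewrite (e1 _ ki); apply/andP; split; lra.
  apply: contraNT; rewrite negb_and -ltnNge -leqNgt => /orP[ki|ki].
    by rewrite d1 // e1 ?subrr //; apply: ltn_trans (m_lt i).
  by rewrite e0 // d0 ?subrr //; apply: leq_trans ki; apply: m_mono.
pose bad i := has (fun k => eta <= `|x k|) (iota (m i) (m i.+2 - m i)).
pose c i : R := if (l <= i)%N && ~~ bad i then 1 else 0.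
have c01 i : 0 <= c i <= 1 by rewrite /c; case: ifP; rewrite ?lexx ?ler01.
pose g k := \sum_(i < n) c i * (E i k * x k).
have gx k : `|g k| <= `|x k|.
  apply: le_trans (ler_norm_sum _ _ _) _.
  apply: (@le_trans _ _ (\sum_(i < n) E i k * `|x k|)).
    apply: ler_sum => i _; have [/andP[e0 e1] _] := E01 i k (ltn_ord i).
    have /andP[ci0 ci1] := c01 i.
    by rewrite !normrM (ger0_norm ci0) (ger0_norm e0) ler_piMl // mulr_ge0.
  rewrite -mulr_suml /E (telescope_from (fun i => D i k) ln) ler_piMl //.
  have [|[d01 _ _] _] := DP n; first by rewrite ln leqnn.
  have [|[e01 _ _] _] := DP l; first by rewrite ln leqnn.
  by have /andP[? ?] := d01 k; have /andP[? ?] := e01 k; lra.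
have E_bad i k : (i < n)%N -> eta <= `|x k| -> c i * (E i k * x k) = 0.
  move=> i_n xk; have [->|] := eqVneq (E i k) 0; first by rewrite mul0r mulr0.
  move=> /(E01 i k i_n).2 /andP[k1 k2].
  have -> : c i = 0; last by rewrite mul0r.
  rewrite /c; case: ifP => // /andP[_ /hasPn/(_ k)].
  rewrite mem_iota subnKC; last exact: leq_trans (ltnW k2).
  by rewrite k1 k2 => /(_ isT); rewrite xk.
have g_eta k : `|g k| <= eta.
  have [xk|/ltW xk] := leP eta `|x k|; last exact: le_trans (gx k) xk.
  by rewrite /g big1 ?normr0 ?(ltW eta0) // => i _; exact: E_bad.
have g_above : supported_above (m l) g.
  move=> k kl; rewrite /g big1 // => i _.
  have [->|/(E01 i k (ltn_ord i)).2/andP[k1 _]] := eqVneq (E i k) 0.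
    by rewrite mul0r mulr0.
  rewrite /c; case: ifP => [/andP[li _]|]; last by rewrite mul0r.
  by move: (leq_trans (leq_trans kl (m_mono li)) k1); rewrite ltnn.
have g_below : supported_below (m n.+1) g.
  move=> k kn; rewrite /g big1 // => i _.
  have [->|/(E01 i k (ltn_ord i)).2/andP[_ k2]] := eqVneq (E i k) 0.
    by rewrite mul0r mulr0.
  have : (m i.+2 <= m n.+1)%N by apply: m_mono; rewrite ltnS.
  by move=> /(leq_trans k2)/leq_trans/(_ kn); rewrite ltnn.
pose b i := c i * a i.
have b_above : supported_above L b.
  by move=> k kL; rewrite /b a_above ?mulr0 //; exact: leq_trans Ll.
exists n, b, g; split.
- split; first exact: leq_trans ln.
  by split=> // k kn; rewrite /b a_below // mulr0.
- by split=> // k kL; apply: g_above; apply: leq_trans kL _; exact: m_mono.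
- by split=> //; exact: schreier_bounded_le gx xK.
- pose h i k : R := (m i <= k)%N%:R.
  pose H := [seq k <- iota (m l) (m n.+1 - m l) | eta <= `|x k|].
  have mln : (m l <= m n.+1)%N by apply: m_mono; exact: leqW.
  have HN : (size H < N)%N.
    apply: (few_large_coords xK KN (n := m l)).
    - by apply: leqW; apply: leq_trans Nl (m_ge l).
    - by rewrite filter_uniq // iota_uniq.
    - by move=> k; rewrite mem_filter mem_iota => /andP[-> /andP[-> _]].
  have h_mono i j k : (i <= j)%N -> h j k <= h i k.
    move=> ij; rewrite /h ler_nat; case: (leqP (m j) k) => // mjk.
    by rewrite (leq_trans (m_mono ij) mjk).
  have count_bad : \sum_(i < n) (((l <= i)%N && bad i)%:R : R) <= 2 * N%:R.
    apply: (@le_trans _ _ (\sum_(i < n) \sum_(k <- H)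
        (if (l <= i)%N then h i k - h i.+2 k else 0))).
      apply: ler_sum => i _; have [li|_] /= := leqP l i; last by rewrite big1.
      have h0 k : 0 <= h i k - h i.+2 k by rewrite subr_ge0 h_mono // leqW.
      have [/hasP[k kI xk]|_] := boolP (bad i); last exact: sumr_ge0.
      move: kI; rewrite mem_iota subnKC; last by apply: m_mono; exact: leqW.
      move=> /andP[k1 k2].
      have kH : k \in H.
        rewrite mem_filter xk mem_iota subnKC //.
        rewrite (leq_trans (m_mono li) k1) /=; apply: leq_trans k2 _.
        by apply: m_mono; rewrite ltnS.
      rewrite (big_rem k kH) /= {1 2}/h k1 leqNgt k2 /= subr0 lerDl.
      exact: sumr_ge0.
    rewrite exchange_big.
    apply: (@le_trans _ _ (\sum_(k <- H) 2)); last first.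
      rewrite big_const_seq iter_addr_0 count_predT -[leLHS]mulr_natr.
      by rewrite ler_pM2l // ler_nat ltnW.
    apply: ler_sum => k _.
    have := telescope_from (fun i => - (h i k + h i.+1 k)) ln.
    have -> : \sum_(i < n) (if (l <= i)%N then
       - (h i.+1 k + h i.+2 k) - - (h i k + h i.+1 k) else 0) =
       \sum_(i < n) (if (l <= i)%N then h i k - h i.+2 k else 0).
      by apply: eq_bigr => i _; case: ifP => // _; ring.
    move=> ->; have h01 j : 0 <= h j k <= 1 by rewrite /h ler0n lern1 leq_b1.
    have := h01 l; have := h01 l.+1; have := h01 n; have := h01 n.+1.
    by move: (h l k) (h l.+1 k) (h n k) (h n.+1 k) => ? ? ? ?
      /andP[? ?] /andP[? ?] /andP[? ?] /andP[? ?]; lra.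
  have diff : `|synthesis z n (fun i => a i - b i)| <= 1 / 2.
    apply: le_trans (ler_norm_sum _ _ _) _.
    apply: (@le_trans _ _ (\sum_(i < n) gamma * ((l <= i)%N && bad i)%:R)).
      apply: ler_sum => i _; rewrite normrZ (zW i).2 mulr1 /b /c.
      have [li|il] := leqP l i; last by rewrite a_above // mulr0 subrr normr0 mulr0.
      by case: (bad i) => /=; rewrite ?mul0r ?subr0 ?mulr1 // mul1r subrr normr0 mulr0.
    rewrite -mulr_sumr; apply: le_trans (ler_wpM2l (ltW gamma0) count_bad) _.
    rewrite /gamma le_eqVlt; apply/orP; left; apply/eqP.
    by move: N_gt0; move: (N%:R) => q q0; field; rewrite gt_eqF.
  rewrite synthesisB in diff.
  have := ler_normD (synthesis z n b) (synthesis z n a - synthesis z n b).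
  rewrite [X in `|X| <= _]addrC subrK a1.
  by move: diff; move: (`|synthesis z n b|) (`|_ - _|) => *; lra.
- have -> : synthesis t (m n.+1) g = synthesis t NX g.
    rewrite -(synthesis_widen t (leq_addr NX (m n.+1)) g_below).
    rewrite (synthesis_widen t (leq_addl (m n.+1) NX)) // => k kN.
    by apply/eqP; rewrite -normr_le0 -(normr0 R) -(xN k kN) gx.
  rewrite (synthesis_sum t NX n c (fun i k => E i k * x k)) /synthesis -sumrB.
  apply: le_trans (ler_norm_sum _ _ _) _.
  (* Each piece inherits the errors of two cuts, [(1 / 2) ^+ i] and [(1 / 2) ^+ i.+1]. *)
  apply: (@le_trans _ _ (\sum_(i < n) 2 * (if (l <= i)%N then (1 / 2) ^+ i else 0))).
    apply: ler_sum => i _; rewrite /b.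
    have [li|il] := leqP l i; last first.
      by rewrite /c leqNgt il /= mul0r !scale0r subrr normr0 mulr0.
    have [|_ h1] := DP i; first by rewrite li ltnW.
    have [|_ h2] := DP i.+1; first by rewrite ltn_ord ltnW.
    rewrite -scalerA -scalerBr normrZ.
    have /andP[ci0 ci1] := c01 i; rewrite (ger0_norm ci0).
    apply: le_trans (ler_piMl (normr_ge0 _) ci1) _.
    have -> : a i *: z i = synthesis z i.+1 a - synthesis z i a.
      by rewrite synthesisS addrAC subrr add0r.
    rewrite -/(synthesis t NX (fun k => E i k * x k)).
    have -> : synthesis t NX (fun k => E i k * x k) =
        synthesis t NX (fun k => D i.+1 k * x k) - synthesis t NX (fun k => D i k * x k).
      by rewrite -synthesisB; apply: eq_bigr => k _; rewrite /E li mulrBl.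
    rewrite distrC in h2; apply: le_trans (dist_diff h2 h1) _.
    by rewrite exprS; have : 0 <= (1 / 2) ^+ i :> R by []; lra.
  rewrite -mulr_sumr; apply: le_trans half_l.
  by have := geometric_tail l n; lra.
Qed.

(** Successive flat blocks are chosen with [eta = K / (m L).+1], the decay required by
    [schreier_bounded_blocks] for liftings starting at [m L]. The upper constant is [C * (K + K)]
    for the liftings plus [2] for the errors [(1 / 2) ^+ j]. *)
Lemma contains_c0_unbounded : contains_c0 Z.
Proof.
have step (j L : nat) : exists N (ag : (nat -> R) * (nat -> R)), [/\ (L <= N)%N,
    supported_above L ag.1 /\ supported_below N ag.1,
    supported_above (m L) ag.2 /\ supported_below (m N) ag.2,
    schreier_bounded K ag.2 /\ (forall k, `|ag.2 k| <= K / (m L).+1%:R) &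
    1 / 2 <= `|synthesis z N ag.1| /\
    `|synthesis z N ag.1 - synthesis t (m N) ag.2| <= (1 / 2) ^+ j].
  have eta0 : 0 < K / (m L).+1%:R by rewrite divr_gt0 // ltr0n.
  have theta0 : 0 < (1 / 2) ^+ j :> R by rewrite exprn_gt0.
  have [n [a [g [[Ln [aL an]] gs gK a_ge ag]]]] := flat_block L eta0 theta0.
  have anS : supported_below n.+1 a by move=> k nk; apply: an; exact: ltnW.
  (* The block ends at [n.+1], since its lifting reaches up to [m n.+1]. *)
  exists n.+1, (a, g); split=> //; first exact: leqW.
  by rewrite /= (synthesis_widen z (leqnSn n) an).
have [s [ag [_ P]]] := sequential_choice step 0%N.
pose a j := (ag j).1; pose g j := (ag j).2.
have s_mono j : (s j <= s j.+1)%N by have [] := P j.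
have smono : {homo s : i j / (i <= j)%N} := homo_leq (@leqnn) leq_trans s_mono.
have a_above j : supported_above (s j) (a j) by have [_ []] := P j.
have a_below j : supported_below (s j.+1) (a j) by have [_ []] := P j.
pose v j := synthesis z (s j.+1) (a j).
have vE N j : (s j.+1 <= N)%N -> v j = synthesis z N (a j).
  by move=> sN; rewrite /v (synthesis_widen z sN (a_below j)).
apply: (@contains_c0_of_sequence _ _ Z v (C * (K + K) + 2)) => //.
- by move=> j; rewrite /v; apply: (synthesis_mem lZ) => i _; right; have [[]] := zW i.
- move=> n N b nN; rewrite (synthesis_split v b nN).
  have -> : synthesis v n b = synthesis z (s n) (fun i => \sum_(j < n) b j * a j i).
    rewrite synthesis_sum; apply: eq_bigr => j _.
    by rewrite (@vE (s n)) //; apply: smono.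
  (* The first [n] blocks use only [z i] with [i < s n], and the later ones lie in
     [W (m (s n).+1)]. *)
  apply: mazur; apply: synthesis_mem; first exact: kernel_subspace.
  move=> j _; have [jn|nj] := ltnP j n; first by left; exact: tail_above.
  right; apply: (@synthesis_deep (s n) (s j.+1) (a j)) => k kn; apply: a_above.
  exact: leq_trans kn (smono _ _ nj).
- by move=> j; have [_ _ _ _ []] := P j.
- move=> J b B B0 bB.
  have small j : `|v j - synthesis t (m (s j.+1)) (g j)| <= (1 / 2) ^+ j.
    by have [_ _ _ _ []] := P j.
  have gs j : supported_above (m (s j)) (g j) /\ supported_below (m (s j.+1)) (g j).
    by have [] := P j.
  have gK j : schreier_bounded K (g j) by have [_ _ _ []] := P j.
  have g_small j k : `|g j k| <= K / (m (s j)).+1%:R.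
    by have [_ _ _ [_ h] _] := P j; exact: h.
  have ms_mono j : (m (s j) <= m (s j.+1))%N by exact/m_mono/s_mono.
  have upper := synC (m (s J))
    (@schreier_bounded_blocks R K g (m \o s) ms_mono gs gK g_small b B J bB B0).
  rewrite synthesis_sum in upper.
  rewrite -[synthesis v J b](subrK (\sum_(j < J) b j *: synthesis t (m (s J)) (g j))).
  apply: le_trans (ler_normD _ _) _; rewrite mulrDl addrC.
  apply: lerD; first by rewrite -mulrA [(K + K) * B]mulrC.
  rewrite /synthesis -sumrB; apply: le_trans (ler_norm_sum _ _ _) _.
  apply: (@le_trans _ _ (\sum_(j < J) B * (if (0 <= j)%N then (1 / 2) ^+ j else 0))).
    apply: ler_sum => j _; rewrite -scalerBr normrZ; apply: ler_pM => //.
      exact: bB.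
    rewrite -/(synthesis t (m (s J)) (g j)).
    by rewrite (synthesis_widen t _ (gs j).2) //; apply/m_mono/smono.
  rewrite -mulr_sumr mulrC ler_wpM2r //.
  by apply: le_trans (geometric_tail 0 J) _; rewrite expr0 mulr1.
Qed.

End Saturation.

Theorem theoremB (R : realType) (Y : completeNormedModType R) :
  quotient_of_schreier Y -> c0_saturated Y.
Proof.
move=> /quotient_representation[t [C [K [K_gt0 synC lift]]]] Z lZ cZ iZ.
have [phi [cphi dphi]] := separable_dual synC lift.
have [z [m [m_lt mazur cuts zW]]] :=
  basic_sequence cphi dphi lZ iZ K_gt0 synC.
(* Either [z] is not dominated by the basis of [c_0] and flat blocks exist, or a uniform bound [M]
   makes [z] itself span a copy of [c_0]. *)
have [unb|bnd] := pselect (forall M : R, exists n a,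
    (forall i, (i < n)%N -> `|a i| <= 1) /\ M < `|synthesis z n a|).
  exact: (contains_c0_unbounded cphi lZ cZ K_gt0 synC lift m_lt mazur cuts zW unb).
have [M MP] : exists M : R, forall n a, (forall i, (i < n)%N -> `|a i| <= 1) ->
    `|synthesis z n a| <= M.
  apply: contrapT => no; apply: bnd => M; apply: contrapT => nM; apply: no.
  exists M => n a a1; rewrite leNgt; apply/negP => lt; apply: nM.
  by exists n, a.
apply: (@contains_c0_of_sequence _ _ Z z M) => //.
- by move=> j; have [[]] := zW j.
- move=> n N b nN; rewrite (synthesis_split z b nN); apply: mazur.
  by apply: (synthesis_deep cphi lZ m_lt zW); exact: tail_above.
- by move=> j; rewrite (zW j).2; lra.
(* The bound is known for coefficients at most [1]; rescaling by [B^-1] requires treating [B = 0]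
   apart. *)
- move=> N b B; rewrite le_eqVlt => /predU1P[<- b0|B0 bB].
    rewrite mulr0 /synthesis big1 ?normr0 // => j _.
    by have := b0 j (ltn_ord j); rewrite normr_le0 => /eqP ->; rewrite scale0r.
  have := MP N (fun k => B^-1 * b k + 0).
  rewrite synthesis_lin synthesis0 addr0 normrZ gtr0_norm ?invr_gt0 //.
  rewrite ler_pdivrMl // mulrC; apply=> i iN.
  by rewrite addr0 normrM gtr0_norm ?invr_gt0 // ler_pdivrMl // mulr1 bB.
Qed.
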